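(* Let $k$ be a field with $\operatorname{char} k=0$ or $\operatorname{char} k>7$, let $\mathcal{O}$ be an octonion algebra over $k$, let $G=\operatorname{Aut}(\mathcal{O})$ (a group of type $G_2$) with Lie algebra $\mathfrak{g}_2=\operatorname{Der}(\mathcal{O})$, and let $W=e^{\perp}$ be the space of pure octonions. Then the algebra $A(\mathfrak{g}_2)$ (with product $\diamond$) is isomorphic to the symmetric square $\mathrm{S}^2W$ equipped with the bilinear multiplication given by $$ab\star cd=\tfrac{1}{12}\big(\langle a,c\rangle bd+\langle a,d\rangle bc+\langle b,c\rangle ad+\langle b,d\rangle ac+\langle a,b\rangle cd+\langle c,d\rangle ab\big)-\tfrac{1}{48}\big((a*c)(b*d)+(a*d)(b*c)\big)$$ for $a,b,c,d\in W$.
   Context: An octonion algebra over $k$ is an $8$-dimensional $k$-algebra $\mathcal{O}$ with identity $e$ and a nondegenerate quadratic form $N$ with $N(xy)=N(x)N(y)$; put $\langle x,y\rangle=N(x+y)-N(x)-N(y)$ and $W=e^\perp$ (pure octonions, dimension 7). The Malcev product is $a*b=ab-ba$; it maps $W\times W$ to $W$. In $\mathrm{S}^2W$, $ab$ denotes the symmetric product of $a,b\in W$ (not the octonion product). The algebra $A(\mathfrak g)$ (Chayet–Garibaldi), for $\mathfrak g=\mathfrak g_2$, with Killing form $K$ and dual Coxeter number $h^\vee=4$: write $x\bullet y=\tfrac12(xy+yx)$ for endomorphisms $x,y$. Define the linear map $S:\mathrm{S}^2\mathfrak g\to\operatorname{End}(\mathfrak g)$ by $$S(XY)=h^\vee\,\operatorname{ad}X\bullet\operatorname{ad}Y+\tfrac12\big(X\,K(Y,\cdot)+Y\,K(X,\cdot)\big),$$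 and let $A(\mathfrak g)=\operatorname{Im}(S)$, with the (well-defined) commutative bilinear product determined by $$\begin{aligned}S(AB)\diamond S(CD)=\;&\tfrac{h^\vee}{2}\Big(S\big(A\cdot(\operatorname{ad}C\bullet\operatorname{ad}D)B\big)+S\big((\operatorname{ad}C\bullet\operatorname{ad}D)A\cdot B\big)+S\big(C\cdot(\operatorname{ad}A\bullet\operatorname{ad}B)D\big)\\&+S\big((\operatorname{ad}A\bullet\operatorname{ad}B)C\cdot D\big)+S([A,C]\cdot[B,D])+S([A,D]\cdot[B,C])\Big)\\&+\tfrac14\big(K(A,C)S(BD)+K(A,D)S(BC)+K(B,C)S(AD)+K(B,D)S(AC)\big)\end{aligned}$$ for $A,B,C,D\in\mathfrak g$, where $X\cdot Y$ inside $S$ denotes the product in $\mathrm{S}^2\mathfrak g$. *)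

(* Defs.v *)
From HB Require Import structures.
From mathcomp Require Import all_boot all_order all_algebra.
From mathcomp Require Import ring.

Set Implicit Arguments.
Unset Strict Implicit.
Unset Printing Implicit Defensive.

Import GRing.Theory passmx.
Local Open Scope ring_scope.

Lemma linfunE (k : fieldType) (U V : vectType k) (f : U -> V) :
  linear f -> linfun f =1 f.
Proof.
move=> lf; pose flM := GRing.isLinear.Build _ _ _ _ f lf.
pose fL : {linear U -> V} := HB.pack f flM.
exact: (lfunE fL).
Qed.

Lemma lmod_eq (k : fieldType) (V : vectType k) (v w : V) :
  (forall phi : V -> k, (forall x y, phi (x + y) = phi x + phi y) ->
    (forall a x, phi (a *: x) = a * phi x) -> phi v = phi w) -> v = w.
Proof.
move=> vw; rewrite (coord_vbasis (memvf v)) (coord_vbasis (memvf w)).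
apply: eq_bigr => i _; congr (_ *: _); apply: vw => [x y|a x].
  exact: linearD.
exact: linearZ.
Qed.

(* Not necessarily associative k-algebras: a vectType with a product. *)
Definition alg_isomorphic (k : fieldType) (U V : vectType k)
    (mU : U -> U -> U) (mV : V -> V -> V) : Prop :=
  exists2 f : {linear U -> V},
    bijective f & forall x y, f (mU x y) = mV (f x) (f y).

Section SymmetricSquare.

Variables (k : fieldType) (V : vectType k).

Local Notation n := (\dim {:V}).
Local Notation basis := (vbasis {:V}).

(* With e the chosen basis of V, the vector t stands for
   \sum_(i <= j) t_ij e_i e_j, i.e., for the degree 2 part of the symmetric
   algebra of V; this is valid in every characteristic. The basis is
   immaterial by sym2_liftE and sym2_ext (the universal property). *)
Definition sym2_index := {ij : 'I_n * 'I_n | (ij.1 <= ij.2)%N}.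
Definition sym2 : vectType k := {ffun sym2_index -> k^o}.

Definition sprod (a b : V) : sym2 :=
  [ffun ij : sym2_index =>
    let: (i, j) := val ij in
    if i == j then coord basis i a * coord basis i b
    else coord basis i a * coord basis j b + coord basis j a * coord basis i b].

(* Junk unless f is bilinear and symmetric. *)
Definition sym2_lift (U : vectType k) (f : V -> V -> U) : 'Hom(sym2, U) :=
  linfun (fun t : sym2 =>
    \sum_(ij : sym2_index) t ij *: f basis`_(val ij).1 basis`_(val ij).2).

Lemma sprod_bilinear : bilinear_for *:%R *:%R sprod.
Proof.
by split=> u a x y; apply/ffunP=> -[[i j] /= leij]; rewrite !ffunE /=;
  case: eqP => _; rewrite !linearP /= /GRing.scale /=; ring.
Qed.
HB.instance Definition _ :=
  bilinear_isBilinear.Build k V V sym2 *:%R *:%R sprod sprod_bilinear.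

Lemma sprodC : commutative sprod.
Proof.
move=> a b; apply/ffunP=> -[[i j] /= leij]; rewrite !ffunE /=.
by case: eqP => _; ring.
Qed.

Lemma sym2_lift_linear (U : vectType k) (f : V -> V -> U) :
  linear (fun t : sym2 =>
    \sum_(ij : sym2_index) t ij *: f basis`_(val ij).1 basis`_(val ij).2).
Proof.
move=> a x y; rewrite scaler_sumr -big_split; apply: eq_bigr => ij _ /=.
by rewrite !ffunE scalerDl scalerA.
Qed.

Let sum_sym2 (U : zmodType) (g : 'I_n -> 'I_n -> U) :
  \sum_i \sum_j g i j =
  \sum_(ij : sym2_index) (if (val ij).1 == (val ij).2 then
     g (val ij).1 (val ij).2 else g (val ij).1 (val ij).2 + g (val ij).2 (val ij).1).
Proof.
pose P (ij : 'I_n * 'I_n) := (ij.1 <= ij.2)%N.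
pose F (ij : 'I_n * 'I_n) :=
  if ij.1 == ij.2 then g ij.1 ij.2 else g ij.1 ij.2 + g ij.2 ij.1.
have -> : \sum_(ij : sym2_index) (if (val ij).1 == (val ij).2 then
    g (val ij).1 (val ij).2
    else g (val ij).1 (val ij).2 + g (val ij).2 (val ij).1) =
    \sum_(ij | P ij) F ij.
  have [/existsP[i0 Pi0]|/existsPn nP] := boolP [exists ij, P ij].
    rewrite (reindex_omap val (insub : _ -> option sym2_index)) /=; last first.
      by move=> ij Pij; rewrite insubT.
    by apply: eq_bigl => x; rewrite valK eqxx; case: x => ij Pij; rewrite /P /= Pij.
  rewrite !big1 // => [ij Pij | [ij Pij] _].
    by have := nP ij; rewrite Pij.
  by have := nP ij; rewrite /P Pij.
rewrite pair_big /= (bigID P) /= [in RHS](bigID (fun ij => ij.1 == ij.2)) /=.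
rewrite (bigID (fun ij => ij.1 == ij.2) P) /= -addrA; congr (_ + _).
  by apply: eq_bigr => ij /andP[_ eij]; rewrite /F eij.
have -> : \sum_(ij | P ij && (ij.1 != ij.2)) F ij =
          \sum_(ij | P ij && (ij.1 != ij.2)) (g ij.1 ij.2 + g ij.2 ij.1).
  by apply: eq_bigr => ij /andP[_ /negPf nij]; rewrite /F nij.
rewrite big_split /=; congr (_ + _).
rewrite (reindex_inj (h := fun ij => (ij.2, ij.1))) /=; last first.
  by move=> [i j] [i' j'] [-> ->].
apply: eq_bigl => -[i j]; rewrite /P /= -ltnNge ltn_neqAle andbC.
by rewrite (inj_eq val_inj).
Qed.

Lemma sym2_liftE (U : vectType k) (f : V -> V -> U) (a b : V) :
  bilinear_for *:%R *:%R f -> (forall x y, f x y = f y x) ->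
  sym2_lift f (sprod a b) = f a b.
Proof.
move=> bf fC; pose fM := bilinear_isBilinear.Build k V V U *:%R *:%R f bf.
pose fB : {bilinear V -> V -> U} := HB.pack f fM.
rewrite (linfunE (sym2_lift_linear f)).
rewrite [in RHS](coord_vbasis (memvf a)) [in RHS](coord_vbasis (memvf b)).
rewrite -[f]/(fB : V -> V -> U) linear_sumlz.
under [RHS]eq_bigr => i _ do rewrite linear_sumr.
under [RHS]eq_bigr => i _ do under eq_bigr => j _
  do rewrite linearZl_LR linearZr_LR /= scalerA.
rewrite sum_sym2; apply: eq_bigr => -[[i j] /= leij] _.
rewrite ffunE /=; case: eqP => [->//|_].
by rewrite scalerDl [f basis`_j _]fC.
Qed.

Lemma sprod_basis (ij ij' : sym2_index) :
  sprod basis`_(val ij).1 basis`_(val ij).2 ij' = (ij == ij')%:R.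
Proof.
have fb : free basis by apply: basis_free (vbasisP _).
rewrite -val_eqE; case: ij ij' => -[i j] /= leij [[i' j'] /= leij'].
rewrite xpair_eqE !ffunE /= !coord_free //.
case: (eqVneq i' j') => [eij'|nij']; first by subst j'; rewrite -natrM mulnb.
rewrite -!natrM -natrD !mulnb; congr (_%:R).
have [eji'|_] := eqVneq j i'; last by rewrite andbF addn0.
have [eij'|_] := eqVneq i j'; last by rewrite addn0.
by case/eqP: nij'; apply/val_inj/anti_leq; rewrite leij' -eji' -eij' leij.
Qed.

Lemma sym2_span (t : sym2) :
  t = \sum_(ij : sym2_index)
        t ij *: sprod basis`_(val ij).1 basis`_(val ij).2.
Proof.
apply/ffunP=> ij'; rewrite sum_ffunE (bigD1 ij') //= big1 => [|ij nij].
  by rewrite ffunE sprod_basis eqxx addr0 /GRing.scale /= mulr1.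
by rewrite ffunE sprod_basis (negPf nij) scaler0.
Qed.

Lemma sym2_ext (U : vectType k) (f g : {linear sym2 -> U}) :
  (forall a b, f (sprod a b) = g (sprod a b)) -> f =1 g.
Proof.
move=> fg t; rewrite [t]sym2_span !linear_sum; apply: eq_bigr => ij _.
by rewrite !linearZ fg.
Qed.

End SymmetricSquare.

Notation "a \s* b" := (sprod a b) (at level 40, left associativity).

Definition lftrace (k : fieldType) (V : vectType k) (f : 'End(V)) : k :=
  \tr (mxof (vbasis {:V}) (vbasis {:V}) f).

Section Trace.

Variables (k : fieldType) (V : vectType k).

Lemma lftrace_linear : scalar (@lftrace k V).
Proof. by move=> a f g; rewrite /lftrace !linearP. Qed.

Lemma lftraceC (f g : 'End(V)) : lftrace (f \o g) = lftrace (g \o f).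
Proof.
by rewrite /lftrace !(mxof_comp _ _ (vbasisP _)) mxtrace_mulC.
Qed.

End Trace.

HB.instance Definition _ (k : fieldType) (V : vectType k) :=
  GRing.isLinear.Build k 'End(V) k *%R (@lftrace k V) (@lftrace_linear k V).

Record lieAlgebra (k : fieldType) := LieAlgebra {
  lie_space :> vectType k;
  lie_br : {bilinear lie_space -> lie_space -> lie_space};
  lie_brxx : forall x, lie_br x x = 0;
  lie_jacobi : forall x y z,
    lie_br x (lie_br y z) + lie_br y (lie_br z x) + lie_br z (lie_br x y) = 0
}.

Arguments lie_br {k l}.

Section ChayetGaribaldi.

(* The Chayet-Garibaldi algebra A(L), with h the dual Coxeter number of L
   seen as a scalar. *)
Variables (k : fieldType) (L : lieAlgebra k) (h : k).

Implicit Types (X Y Z A B C D : L).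

Local Notation "[ X , Y ]" := (lie_br X Y) : ring_scope.

Definition ad X : 'End(L) := linfun (lie_br X).

Definition bullet (x y : 'End(L)) : 'End(L) :=
  2^-1 *: ((x \o y)%VF + (y \o x)%VF).

Definition killing X Y : k := lftrace (ad X \o ad Y).

(* the rank one operator X K(Y, -) *)
Definition killing_op X Y : 'End(L) := linfun (fun Z => killing Y Z *: X).

(* the map S, and its image A(L) *)
Definition cg_S : 'Hom(sym2 L, 'End(L)) :=
  sym2_lift (fun X Y =>
    h *: bullet (ad X) (ad Y) + 2^-1 *: (killing_op X Y + killing_op Y X)).

Definition cg_space : {vspace 'End(L)} := limg cg_S.

Definition cg_formula A B C D : 'End(L) :=
  (h / 2) *: (cg_S (A \s* bullet (ad C) (ad D) B)
            + cg_S (bullet (ad C) (ad D) A \s* B)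
            + cg_S (C \s* bullet (ad A) (ad B) D)
            + cg_S (bullet (ad A) (ad B) C \s* D)
            + cg_S ([A, C] \s* [B, D])
            + cg_S ([A, D] \s* [B, C]))
  + 4^-1 *: (killing A C *: cg_S (B \s* D) + killing A D *: cg_S (B \s* C)
           + killing B C *: cg_S (A \s* D) + killing B D *: cg_S (A \s* C)).

Definition cg_prod : 'Hom(sym2 L, 'Hom(sym2 L, 'End(L))) :=
  sym2_lift (fun A B => sym2_lift (fun C D => cg_formula A B C D)).

(* cg_S^-1 picks preimages under cg_S; the choice is irrelevant by cg_mulE. *)
Definition cg_mul (u v : subvs_of cg_space) : subvs_of cg_space :=
  vsproj cg_space
    (cg_prod ((cg_S^-1)%VF (vsval u)) ((cg_S^-1)%VF (vsval v))).

Lemma adE X Y : ad X Y = [X, Y]. Proof. exact: lfunE. Qed.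

Lemma ad_linear : linear ad.
Proof.
by move=> a X Y; apply/lfunP=> Z; rewrite !(adE, add_lfunE, scale_lfunE) linearPl.
Qed.
HB.instance Definition _ := GRing.isLinear.Build k L 'End(L) *:%R ad ad_linear.

Lemma lie_brC X Y : [X, Y] = - [Y, X].
Proof.
apply/eqP; rewrite -addr_eq0; apply/eqP.
have := lie_brxx (X + Y).
by rewrite linearDl !linearDr /= !lie_brxx add0r addr0.
Qed.

Lemma ad_br X Y : ad [X, Y] = (ad X \o ad Y)%VF - (ad Y \o ad X)%VF.
Proof.
apply/lfunP=> Z; rewrite !(add_lfunE, opp_lfunE, comp_lfunE, adE).
have /eqP := lie_jacobi X Y Z; rewrite addrC addr_eq0 => /eqP E.
rewrite lie_brC E opprK [X in [_, X]]lie_brC linearNr.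
by rewrite [[Y, [Z, X]]](_ : _ = - [Y, [X, Z]]) // -linearNr -lie_brC.
Qed.

Lemma killingC X Y : killing X Y = killing Y X.
Proof. exact: lftraceC. Qed.

Lemma killing_linear X : scalar (killing X).
Proof.
by move=> a Y Z; rewrite /killing ad_linear comp_lfunDr -comp_lfunZr lftrace_linear.
Qed.

Lemma killing_inv X Y Z : killing [Z, X] Y = - killing X [Z, Y].
Proof.
apply/eqP; rewrite -addr_eq0 /killing !ad_br comp_lfunDl comp_lfunDr.
rewrite comp_lfunNl comp_lfunNr !linearD !linearN /=.
rewrite -!comp_lfunA [lftrace (ad Z \o _)]lftraceC -comp_lfunA.
by rewrite addrA subrK subrr.
Qed.

Lemma killing_opE X Y Z : killing_op X Y Z = killing Y Z *: X.
Proof.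
apply: linfunE => a Z1 Z2; rewrite killing_linear.
by rewrite scalerDl scalerA.
Qed.

Lemma bullet_bilinear : bilinear_for *:%R *:%R bullet.
Proof.
split=> x a y z /=; rewrite /bullet comp_lfunDl comp_lfunDr.
  rewrite -comp_lfunZl -comp_lfunZr addrACA scalerDr -[a *: _ + a *: _]scalerDr.
  by congr (_ + _); rewrite !scalerA mulrC.
rewrite -comp_lfunZl -comp_lfunZr addrACA scalerDr -[a *: _ + a *: _]scalerDr.
by congr (_ + _); rewrite !scalerA mulrC.
Qed.
HB.instance Definition _ := bilinear_isBilinear.Build k 'End(L) 'End(L) 'End(L)
  *:%R *:%R bullet bullet_bilinear.

Lemma bulletC : commutative bullet.
Proof. by move=> x y; rewrite /bullet addrC. Qed.

Lemma killing_op_bilinear : bilinear_for *:%R *:%R killing_op.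
Proof.
split=> X a Y Z; apply/lfunP=> T; rewrite !(add_lfunE, scale_lfunE, killing_opE).
  by rewrite scalerDr !scalerA mulrC.
rewrite killingC killing_linear scalerDl scalerA.
by rewrite ![killing T _]killingC.
Qed.
HB.instance Definition _ := bilinear_isBilinear.Build k L L 'End(L)
  *:%R *:%R killing_op killing_op_bilinear.

Let lin_comb (V : lmodType k) (a b c : k) (p q r r' s s' : V) :
  b *: (a *: p + q) + c *: ((a *: r + s) + (a *: r' + s')) =
  a *: (b *: p + c *: (r + r')) + (b *: q + c *: (s + s')).
Proof.
rewrite (addrACA _ s) -(scalerDr a r) (scalerDr b) (scalerDr c) addrACA.
by rewrite [in RHS]scalerDr !scalerA !(mulrC a).
Qed.

Lemma cg_S_sprod X Y : cg_S (X \s* Y) =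
  h *: bullet (ad X) (ad Y) + 2^-1 *: (killing_op X Y + killing_op Y X).
Proof.
rewrite /cg_S sym2_liftE //; last first.
  by move=> U T; rewrite bulletC [killing_op _ _ + _]addrC.
split=> U a T1 T2 /=; rewrite ad_linear.
  by rewrite [bullet _ _]linearPl [killing_op _ U]linearPl [killing_op U _]linearPr lin_comb.
by rewrite [bullet _ _]linearPr [killing_op _ U]linearPl [killing_op U _]linearPr lin_comb.
Qed.

Definition sym2_act Z : 'End(sym2 L) :=
  sym2_lift (fun X Y => [Z, X] \s* Y + X \s* [Z, Y]).

Lemma sym2_actE Z X Y :
  sym2_act Z (X \s* Y) = [Z, X] \s* Y + X \s* [Z, Y].
Proof.
rewrite /sym2_act sym2_liftE //; last first.
  by move=> U T; rewrite addrC; congr (_ + _); apply: sprodC.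
split=> U a T1 T2 /=.
  by rewrite linearPr !linearPl addrACA -scalerDr.
by rewrite linearPr !linearPr addrACA -scalerDr.
Qed.

Lemma ad_bullet Z (x y : 'End(L)) :
  (ad Z \o bullet x y)%VF - (bullet x y \o ad Z)%VF =
  bullet ((ad Z \o x)%VF - (x \o ad Z)%VF) y +
  bullet x ((ad Z \o y)%VF - (y \o ad Z)%VF).
Proof.
rewrite /bullet -comp_lfunZl -comp_lfunZr -scalerBr -scalerDr.
congr (_ *: _); rewrite !comp_lfunDl !comp_lfunDr !comp_lfunNl !comp_lfunNr.
rewrite !comp_lfunA addrACA [X in _ = X + _]addrA subrK.
by rewrite [X in _ = _ + X]addrC [X in _ = _ + X]addrA subrK opprD addrACA.
Qed.

Lemma ad_killing_op Z X Y :
  (ad Z \o killing_op X Y)%VF - (killing_op X Y \o ad Z)%VF =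
  killing_op [Z, X] Y + killing_op X [Z, Y].
Proof.
apply/lfunP=> T; rewrite !(add_lfunE, opp_lfunE, comp_lfunE, killing_opE, adE).
by rewrite linearZr_LR /= killing_inv scaleNr.
Qed.

Lemma cg_S_act Z t :
  cg_S (sym2_act Z t) = (ad Z \o cg_S t)%VF - (cg_S t \o ad Z)%VF.
Proof.
pose g0 (t : sym2 L) := (ad Z \o cg_S t)%VF - (cg_S t \o ad Z)%VF.
have g0l : linear g0.
  move=> a x y; rewrite /g0 linearP comp_lfunDl comp_lfunDr.
  by rewrite -comp_lfunZl -comp_lfunZr opprD addrACA -scalerBr.
pose gM := GRing.isLinear.Build _ _ _ _ g0 g0l.
pose g : {linear sym2 L -> 'End(L)} := HB.pack g0 gM.
suff /(_ t) : (cg_S \o sym2_act Z)%FUN =1 g by [].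
apply: sym2_ext => X Y /=.
rewrite sym2_actE linearD /= /g0 !cg_S_sprod.
have := ad_bullet Z (ad X) (ad Y); move: (bullet (ad X) (ad Y)) => b ad_b.
rewrite comp_lfunDl comp_lfunDr -!comp_lfunZl -!comp_lfunZr comp_lfunDl comp_lfunDr.
rewrite opprD [RHS]addrACA -!scalerBr ad_b -!ad_br.
rewrite opprD [X in _ = _ + 2^-1 *: X]addrACA !ad_killing_op.
rewrite [LHS]addrACA -!scalerDr [X in _ = _ + 2^-1 *: (_ + X)]addrC.
by congr (_ + 2^-1 *: _); rewrite addrACA.
Qed.

Local Ltac abstract_ring phi :=
  repeat match goal with |- context [killing ?x ?y] => move: (killing x y) => ? end;
  repeat match goal with |- context [phi ?t] => move: (phi t) => ? end;
  ring.

Let bullet_adE X Y Z :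
  bullet (ad X) (ad Y) Z = 2^-1 *: ([X, [Y, Z]] + [Y, [X, Z]]).
Proof. by rewrite /bullet scale_lfunE add_lfunE !comp_lfunE !adE. Qed.

Let sprod_br X Y Z T : [X, Z] \s* [Y, T] = [Z, X] \s* [T, Y].
Proof. by rewrite lie_brC [[Y, T]]lie_brC linearNl linearNr opprK. Qed.

(* cg_formula as a function of t = A \s* B that depends only on cg_S t: the
   bracketed terms and those in bullet (ad C) (ad D) are its action on t, while
   the terms in K and in bullet (ad A) (ad B) come from the operator cg_S t. *)
Let cg_closed C D t : 'End(L) :=
  (h / 4) *: (cg_S (sym2_act C (sym2_act D t))
            + cg_S (sym2_act D (sym2_act C t)))
  + 2^-1 *: (cg_S (C \s* cg_S t D) + cg_S (cg_S t C \s* D)).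

Let cg_closed_linear C D : linear (cg_closed C D).
Proof.
move=> a t u; apply: lmod_eq => phi phiD phiZ.
rewrite /cg_closed ![in LHS]linearP /= add_lfunE scale_lfunE.
rewrite [in LHS]add_lfunE [in LHS]scale_lfunE linearPl linearPr.
rewrite ![in LHS]linearP /=.
by rewrite !(phiD, phiZ); abstract_ring phi.
Qed.

Let cg_closed0 C D t : cg_S t = 0 -> cg_closed C D t = 0.
Proof.
move=> St0; rewrite /cg_closed !cg_S_act St0 !comp_lfun0l !comp_lfun0r.
rewrite subrr !comp_lfun0l !comp_lfun0r !zero_lfunE.
by rewrite linear0l linear0r !linear0 !(subrr, addr0, scaler0).
Qed.

Lemma cg_formulaC A B C D : cg_formula A B C D = cg_formula C D A B.
Proof.
rewrite /cg_formula [[C, A] \s* _]sprod_br [[C, B] \s* _]sprod_br.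
rewrite ![killing C _]killingC ![killing D _]killingC.
rewrite ![C \s* _]sprodC ![D \s* _]sprodC [[B, C] \s* _]sprodC.
apply: lmod_eq => phi phiD phiZ.
rewrite !(phiD, phiZ); abstract_ring phi.
Qed.

Lemma cg_formula_symr A B C D : cg_formula A B C D = cg_formula A B D C.
Proof.
rewrite /cg_formula [bullet (ad D) (ad C)]bulletC.
rewrite [D \s* bullet _ _ _]sprodC [C \s* bullet _ _ _]sprodC.
apply: lmod_eq => phi phiD phiZ.
rewrite !(phiD, phiZ); abstract_ring phi.
Qed.

Section WellDefined.

Hypothesis n2 : 2%:R != 0 :> k.

Let closedP A B C D : cg_formula A B C D = cg_closed C D (A \s* B).
Proof.
have actE X Y : cg_S (sym2_act X (sym2_act Y (A \s* B))) =
    cg_S ([X, [Y, A]] \s* B) + cg_S ([Y, A] \s* [X, B]) +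
    (cg_S ([X, A] \s* [Y, B]) + cg_S (A \s* [X, [Y, B]])).
  by rewrite sym2_actE linearD /= !sym2_actE !linearD.
have bulr X Y Z T : cg_S (X \s* bullet (ad Z) (ad T) Y) =
    2^-1 *: (cg_S (X \s* [Z, [T, Y]]) + cg_S (X \s* [T, [Z, Y]])).
  by rewrite bullet_adE linearZr_LR linearZ linearDr /= linearD.
have Sr X Y : cg_S (X \s* cg_S (A \s* B) Y) =
    h *: cg_S (X \s* bullet (ad A) (ad B) Y) +
    2^-1 *: (killing B Y *: cg_S (X \s* A) + killing A Y *: cg_S (X \s* B)).
  rewrite [cg_S (A \s* B)]cg_S_sprod; move: (bullet _ _) => b; rewrite add_lfunE !scale_lfunE add_lfunE.
  rewrite !killing_opE linearDr !linearZr_LR linearDr !linearZr_LR /=.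
  by rewrite linearD !linearZ /= linearD !linearZ.
rewrite /cg_formula /cg_closed !actE.
rewrite [bullet _ _ A \s* B]sprodC [bullet _ _ C \s* D]sprodC.
rewrite [cg_S _ C \s* D]sprodC !Sr !bulr.
rewrite [[C, [D, A]] \s* B]sprodC [[D, [C, A]] \s* B]sprodC.
rewrite (sprod_br _ _ C D) (sprod_br _ _ D C).
rewrite ![C \s* _]sprodC ![D \s* _]sprodC.
apply: lmod_eq => phi phiD phiZ; rewrite !(phiD, phiZ).
repeat match goal with |- context [killing ?x ?y] => move: (killing x y) => ? end.
repeat match goal with |- context [phi ?t] => move: (phi t) => ? end.
by field; rewrite n2 (natrM _ 2 2) mulf_neq0.
Qed.

Let formula_bil A B : bilinear_for *:%R *:%R (cg_formula A B).
Proof.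
split=> U a T1 T2 /=; rewrite !(cg_formulaC A) !closedP.
  by rewrite linearPl cg_closed_linear.
by rewrite linearPr cg_closed_linear.
Qed.

Let inner A B t : sym2_lift (fun C D => cg_formula A B C D) t = cg_closed A B t.
Proof.
pose gM := GRing.isLinear.Build _ _ _ _ _ (cg_closed_linear A B).
pose g : {linear sym2 L -> 'End(L)} := HB.pack (cg_closed A B) gM.
apply: (sym2_ext (g := g)) => C D /=.
rewrite sym2_liftE // => [|U T]; last exact: cg_formula_symr.
by rewrite cg_formulaC closedP.
Qed.

Lemma cg_prodE A B C D : cg_prod (A \s* B) (C \s* D) = cg_formula A B C D.
Proof.
rewrite /cg_prod sym2_liftE.
- rewrite sym2_liftE // => U T; exact: cg_formula_symr.
- split=> U a T1 T2 /=; apply/lfunP; apply: sym2_ext => X Y /=.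
    rewrite add_lfunE scale_lfunE !inner.
    rewrite -!closedP !(cg_formulaC X) !closedP.
    by rewrite linearPl cg_closed_linear.
  rewrite add_lfunE scale_lfunE !inner.
  rewrite -!closedP !(cg_formulaC X) !closedP.
  by rewrite linearPr cg_closed_linear.
- move=> U T; apply/lfunP; apply: sym2_ext => X Y /=.
  by rewrite !inner -!closedP cg_formula_symr.
Qed.

Let cg_prod_sum t u : cg_prod t u =
  \sum_ij \sum_ij' (t ij * u ij') *:
    cg_prod ((vbasis {:L})`_(val ij).1 \s* (vbasis {:L})`_(val ij).2)
            ((vbasis {:L})`_(val ij').1 \s* (vbasis {:L})`_(val ij').2).
Proof.
rewrite {1}[t]sym2_span linear_sum sum_lfunE; apply: eq_bigr => ij _.
rewrite {1}[u]sym2_span linear_sum; apply: eq_bigr => ij' _.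
by rewrite !linearZ /= scale_lfunE scalerA mulrC.
Qed.

Lemma cg_prodC t u : cg_prod t u = cg_prod u t.
Proof.
rewrite !cg_prod_sum exchange_big; apply: eq_bigr => ij _.
by apply: eq_bigr => ij' _; rewrite mulrC !cg_prodE cg_formulaC.
Qed.

Let cg_prod_closed t C D : cg_prod t (C \s* D) = cg_closed C D t.
Proof.
rewrite cg_prodC.
pose gM := GRing.isLinear.Build _ _ _ _ _ (cg_closed_linear C D).
pose g : {linear sym2 L -> 'End(L)} := HB.pack (cg_closed C D) gM.
apply: (sym2_ext (g := g)) => A B /=.
by rewrite cg_prodE cg_formulaC closedP.
Qed.

Lemma cg_prod0 t u : cg_S t = 0 -> cg_prod t u = 0.
Proof.
move=> t0; rewrite [u]sym2_span linear_sum big1 // => ij _.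
by rewrite linearZ /= cg_prod_closed cg_closed0 // scaler0.
Qed.

Let cg_S_in t : cg_S t \in cg_space.
Proof. by apply: memv_img; apply: memvf. Qed.

Lemma cg_prod_in t u : cg_prod t u \in cg_space.
Proof.
rewrite cg_prod_sum; apply: rpred_sum => ij _; apply: rpred_sum => ij' _.
rewrite rpredZ // cg_prodE /cg_formula.
by do ?[exact: cg_S_in | apply: rpredD | apply: rpredZ].
Qed.

Lemma cg_mul_S t u :
  vsval (cg_mul (vsproj cg_space (cg_S t)) (vsproj cg_space (cg_S u))) =
  cg_prod t u.
Proof.
rewrite /cg_mul vsprojK ?cg_prod_in // !vsprojK //.
set t' := _ (cg_S t); set u' := _ (cg_S u).
have kt : cg_S (t' - t) = 0 by rewrite linearB /= /t' limg_lfunVK // subrr.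
have ku : cg_S (u' - u) = 0 by rewrite linearB /= /u' limg_lfunVK // subrr.
have /eqP := cg_prod0 u' kt.
rewrite linearB /= add_lfunE opp_lfunE subr_eq0 => /eqP ->.
have /eqP := cg_prod0 t ku.
rewrite linearB /= add_lfunE opp_lfunE subr_eq0 => /eqP E.
by rewrite [LHS]cg_prodC [LHS]E cg_prodC.
Qed.

Lemma cg_mulE A B C D :
  vsval (cg_mul (vsproj cg_space (cg_S (A \s* B)))
                (vsproj cg_space (cg_S (C \s* D)))) = cg_formula A B C D.
Proof. by rewrite cg_mul_S cg_prodE. Qed.

End WellDefined.

End ChayetGaribaldi.

Arguments cg_mul {k} L h u v.

Section Octonions.

Variable k : fieldType.

Definition polar (V : vectType k) (N : V -> k) (x y : V) : k :=
  N (x + y) - N x - N y.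

(* Nondegeneracy is that of the polar form (the same as that of N when
   2 is invertible). *)
Record octonionAlgebra := OctonionAlgebra {
  oct_space :> vectType k;
  oct_mul : {bilinear oct_space -> oct_space -> oct_space};
  oct_unit : oct_space;
  oct_norm : oct_space -> k;
  oct_dim : \dim {:oct_space} = 8%N;
  oct_mul1l : left_id oct_unit oct_mul;
  oct_mul1r : right_id oct_unit oct_mul;
  oct_normZ : forall a x, oct_norm (a *: x) = a ^+ 2 * oct_norm x;
  oct_polar_bilinear : bilinear_for *%R *%R (polar oct_norm);
  oct_nondegenerate :
    forall x, (forall y, polar oct_norm x y = 0) -> x = 0;
  oct_normM : forall x y, oct_norm (oct_mul x y) = oct_norm x * oct_norm y
}.

End Octonions.

Arguments oct_mul {k o}.
Arguments oct_norm {k o}.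
Arguments oct_unit {k o}.

Section Pure.

Variables (k : fieldType) (O : octonionAlgebra k).
Implicit Types (x y z : O) (D : 'End(O)).

Local Notation "x ** y" := (oct_mul x y) (at level 40).
Local Notation e := (@oct_unit k O).

Definition oct_form x y : k := polar oct_norm x y.

Definition pure : {vspace O} := lker (linfun (oct_form e : O -> k^o)).

Definition malcev x y : O := x ** y - y ** x.

Definition is_derivation D : Prop :=
  forall x y, D (x ** y) = D x ** y + x ** D y.

Definition der_defect D : 'Hom(O, 'End(O)) :=
  linfun (fun x => linfun (fun y => D (x ** y) - (D x ** y + x ** D y))).

Definition derivations : {vspace 'End(O)} := lker (linfun der_defect).

HB.instance Definition _ :=
  bilinear_isBilinear.Build k O O k *%R *%R oct_form (oct_polar_bilinear O).

Lemma oct_formC x y : oct_form x y = oct_form y x.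
Proof. by rewrite /oct_form /polar [x + y]addrC addrAC. Qed.

Lemma mem_pure x : (x \in pure) = (oct_form e x == 0).
Proof.
rewrite memv_ker linfunE // => a y z.
exact: (oct_polar_bilinear O).2.
Qed.

Let der_defect_linear1 D x :
  linear (fun y => D (x ** y) - (D x ** y + x ** D y)).
Proof.
move=> a y z; apply: lmod_eq => phi phiD phiZ.
rewrite !(linearPr, linearP) /= -!scaleN1r !(phiD, phiZ); ring.
Qed.

Let der_defectE D x y : der_defect D x y = D (x ** y) - (D x ** y + x ** D y).
Proof.
rewrite /der_defect linfunE; first by rewrite linfunE.
move=> a u v; apply/lfunP=> z; rewrite add_lfunE scale_lfunE !linfunE //.
apply: lmod_eq => phi phiD phiZ.
rewrite !(linearPl, linearP) /= -!scaleN1r !(phiD, phiZ); ring.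
Qed.

Lemma mem_derivations D : reflect (is_derivation D) (D \in derivations).
Proof.
rewrite memv_ker linfunE; last first.
  move=> a D1 D2; apply/lfunP=> x; apply/lfunP=> y.
  rewrite !(add_lfunE, scale_lfunE) !der_defectE !(add_lfunE, scale_lfunE).
  rewrite linearPl linearPr; apply: lmod_eq => phi phiD phiZ.
  by rewrite -!scaleN1r !(phiD, phiZ); ring.
apply: (iffP eqP) => [D0 x y | derD].
  by apply/eqP; rewrite -subr_eq0 -der_defectE D0 !zero_lfunE.
by apply/lfunP=> x; apply/lfunP=> y; rewrite der_defectE derD subrr !zero_lfunE.
Qed.

Let oct_formMr x y t : oct_form (x ** y) (x ** t) = oct_norm x * oct_form y t.
Proof. by rewrite /oct_form /polar -linearDr !oct_normM !mulrBr. Qed.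

Lemma oct_formM x y z t :
  oct_form (x ** y) (z ** t) + oct_form (x ** t) (z ** y) =
  oct_form x z * oct_form y t.
Proof.
have := oct_formMr (x + z) y t.
rewrite !linearDl !linearDr /= !oct_formMr.
rewrite [oct_form (x ** t) _]oct_formC [oct_form x z]/oct_form /polar => E.
rewrite !mulrBl -E; ring.
Qed.

Lemma malcev_pure x y : malcev x y \in pure.
Proof.
rewrite mem_pure /malcev linearBr subr_eq0 /=.
have trE u v : oct_form e (u ** v) =
    oct_form u e * oct_form v e - oct_form u v.
  rewrite -oct_formM !oct_mul1r oct_mul1l addrK.
  by rewrite oct_formC.
by rewrite !trE mulrC [oct_form x y]oct_formC.
Qed.

Lemma der_comm D1 D2 : D1 \in derivations -> D2 \in derivations ->
  (D1 \o D2)%VF - (D2 \o D1)%VF \in derivations.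
Proof.
move=> /mem_derivations d1 /mem_derivations d2; apply/mem_derivations => x y.
rewrite !(add_lfunE, opp_lfunE, comp_lfunE) d1 d2 !(raddfD D1) !(raddfD D2) /= !d1 !d2.
rewrite linearBl linearBr /=; apply: lmod_eq => phi phiD phiZ.
by rewrite -!scaleN1r !(phiD, phiZ); ring.
Qed.

Local Notation Der := (subvs_of derivations).

Definition der_br (X Y : Der) : Der :=
  vsproj derivations
    ((vsval X \o vsval Y)%VF - (vsval Y \o vsval X)%VF).

Lemma der_brE X Y :
  vsval (der_br X Y) = (vsval X \o vsval Y)%VF - (vsval Y \o vsval X)%VF.
Proof. by rewrite vsprojK // der_comm // subvsP. Qed.

Lemma der_br_bilinear : bilinear_for *:%R *:%R der_br.
Proof.
split=> X a Y Z; apply: subvs_inj; rewrite linearP /= !der_brE linearP /=.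
  rewrite comp_lfunDl comp_lfunDr -comp_lfunZl -comp_lfunZr.
  by rewrite opprD addrACA -scalerBr.
rewrite comp_lfunDl comp_lfunDr -comp_lfunZl -comp_lfunZr.
by rewrite opprD addrACA -scalerBr.
Qed.
HB.instance Definition _ :=
  bilinear_isBilinear.Build k Der Der Der *:%R *:%R der_br der_br_bilinear.

Lemma der_brxx X : der_br X X = 0.
Proof. by apply: subvs_inj; rewrite der_brE subrr. Qed.

Lemma der_jacobi X Y Z :
  der_br X (der_br Y Z) + der_br Y (der_br Z X) + der_br Z (der_br X Y) = 0.
Proof.
apply: subvs_inj; rewrite !linearD linear0 /= !der_brE.
rewrite !(comp_lfunDl, comp_lfunDr, comp_lfunNl, comp_lfunNr) !comp_lfunA.
by apply: lmod_eq => phi phiD phiZ; rewrite -(scale0r 0) -!scaleN1r !(phiD, phiZ); ring.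
Qed.

Definition der_lie : lieAlgebra k :=
  @LieAlgebra k Der der_br der_brxx der_jacobi.

Local Notation W := (subvs_of pure).
Local Notation "<| a , b |>" := (oct_form (vsval a) (vsval b)).

Definition malcevW (a b : W) : W := vsproj pure (malcev (vsval a) (vsval b)).

Lemma malcevWE a b : vsval (malcevW a b) = malcev (vsval a) (vsval b).
Proof. by rewrite vsprojK // malcev_pure. Qed.

Let malcevW_bilinear : bilinear_for *:%R *:%R malcevW.
Proof.
split=> a x b c; apply: subvs_inj; rewrite linearP /= !malcevWE linearP /malcev.
  rewrite linearPl linearPr; apply: lmod_eq => phi phiD phiZ.
  by rewrite -!scaleN1r !(phiD, phiZ); ring.
rewrite linearPl linearPr; apply: lmod_eq => phi phiD phiZ.
by rewrite -!scaleN1r !(phiD, phiZ); ring.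
Qed.
HB.instance Definition _ :=
  bilinear_isBilinear.Build k W W W *:%R *:%R malcevW malcevW_bilinear.

Lemma malcevWC a b : malcevW a b = - malcevW b a.
Proof. by apply: subvs_inj; rewrite linearN /= !malcevWE /malcev opprB. Qed.

Definition star_formula (a b c d : W) : sym2 W :=
  12^-1 *: (<|a, c|> *: (b \s* d) + <|a, d|> *: (b \s* c)
          + <|b, c|> *: (a \s* d) + <|b, d|> *: (a \s* c)
          + <|a, b|> *: (c \s* d) + <|c, d|> *: (a \s* b))
  - 48^-1 *: (malcevW a c \s* malcevW b d + malcevW a d \s* malcevW b c).

(* The product of S^2 W extends star_formula bilinearly; see starE. *)
Definition star_lift : 'Hom(sym2 W, 'Hom(sym2 W, sym2 W)) :=
  sym2_lift (fun a b => sym2_lift (fun c d => star_formula a b c d)).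

Definition star (t u : sym2 W) : sym2 W := star_lift t u.

Let star_formulaC a b c d : star_formula a b c d = star_formula c d a b.
Proof.
have mC a' b' c' d' : malcevW a' c' \s* malcevW b' d' =
    malcevW c' a' \s* malcevW d' b'.
  by rewrite malcevWC [malcevW b' d']malcevWC linearNl linearNr opprK.
rewrite /star_formula (mC c d a b) (mC c d b a) [malcevW b c \s* _]sprodC.
rewrite ![oct_form (vsval c) (vsval _)]oct_formC.
rewrite ![oct_form (vsval d) (vsval _)]oct_formC.
rewrite ![c \s* _]sprodC ![d \s* _]sprodC.
apply: lmod_eq => phi phiD phiZ; rewrite -!scaleN1r !(phiD, phiZ).
ring.
Qed.

Let star_formula_symr a b c d : star_formula a b c d = star_formula a b d c.
Proof.
rewrite /star_formula [oct_form (vsval c) (vsval d)]oct_formC [c \s* d]sprodC.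
apply: lmod_eq => phi phiD phiZ; rewrite -!scaleN1r !(phiD, phiZ).
ring.
Qed.

Let star_formula_linear a b d : linear (fun c => star_formula a b c d).
Proof.
move=> x c1 c2; rewrite /star_formula.
apply: lmod_eq => phi phiD phiZ.
rewrite !linearPl !linearPr /= !linearP /= [sprod (_ + _) _]linearPl.
rewrite -!scaleN1r !(phiD, phiZ).
ring.
Qed.

Let star_formula_bilinear a b : bilinear_for *:%R *:%R (star_formula a b).
Proof.
split=> x y c d; first exact: star_formula_linear.
by rewrite !(star_formula_symr a b x); apply: star_formula_linear.
Qed.

Lemma starE a b c d : star (a \s* b) (c \s* d) = star_formula a b c d.
Proof.
rewrite /star /star_lift sym2_liftE; first by rewrite sym2_liftE.
  split=> u x v w /=; apply/lfunP; apply: sym2_ext => c' d' /=.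
    rewrite add_lfunE scale_lfunE !sym2_liftE //.
    by rewrite !(star_formulaC _ u) star_formula_linear.
  rewrite add_lfunE scale_lfunE !sym2_liftE //.
  by rewrite !(star_formulaC u) (star_formula_bilinear c' d').2.
move=> u v; apply/lfunP; apply: sym2_ext => c' d' /=; rewrite !sym2_liftE //.
by rewrite !(star_formulaC _ _ c') star_formula_symr.
Qed.

End Pure.

Arguments star {k} O t u.

(* Main.v *)
(* On the space W of pure octonions put (a, b) = <a, b> / 2 and
   a x b = (a * b) / 2: this is a 7-dimensional cross product, i.e.,
     a x (b x c) + b x (a x c) = (a, c) b + (b, c) a - 2 (a, b) c,
   and g = Der(O) acts on W by skew derivations of x. All computations below
   are consequences of this identity, of dim W = 7 and of the derivation rule
   for traces of products of operators A_u = u x _ and of elements of g.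
     The projection of the skew operator v u^T - u v^T on g is
     D_{u,v} = v u^T - u v^T - A_{u x v} / 3.
   Identify S^2 W with the self-adjoint operators on W, u^2 being u u^T, and put
     T(X^2) = 12 X^2 - tr(X^2) in S^2 W,   Phi(u^2) X = D_{u, X u}.
   Since the Killing form is 4 tr(XY), and tr(X^4) = tr(X^2)^2 / 4 on g, one
     gets
   S = Phi o T. With T onto and Phi injective, Phi is a linear isomorphism from
   S^2 W to A(g), and the multiplicativity of its inverse reduces to
     2 C.(C.p) + T(C Phi(p)C) = p * T(C^2)   (C in g, p in S^2 W),
   an identity between operators when p = u^2. *)
Require Import Defs.
From mathcomp Require Import all_boot all_order all_algebra.
From mathcomp Require Import ring.
Local Open Scope ring_scope.

Set Implicit Arguments.
Unset Strict Implicit.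
Unset Printing Implicit Defensive.

Import GRing.Theory.

(** * Linear functionals and polarization *)

Lemma lmod_eqN (k : fieldType) (V : vectType k) (v w : V) :
  (forall phi : V -> k, (forall x y, phi (x + y) = phi x + phi y) ->
    (forall x, phi (- x) = - phi x) ->
    (forall a x, phi (a *: x) = a * phi x) -> phi v = phi w) -> v = w.
Proof.
move=> vw; apply: lmod_eq => phi phiD phiZ; apply: vw => // x.
by rewrite -scaleN1r phiZ mulN1r.
Qed.

(** Applying an arbitrary linear functional turns an identity of vectors into one of scalars, whose
    atoms for [ring] and [field] are the images of the vectors. *)
Ltac functionals := apply: lmod_eqN; let phi := fresh "phi" in
  let phiD := fresh "phiD" in let phiN := fresh "phiN" in
  let phiZ := fresh "phiZ" in
  move=> phi phiD phiN phiZ; rewrite ?(phiD, phiN, phiZ).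
Ltac lincomb c H := apply: subr0_eq;
  match type of H with
  | ?l = ?r => transitivity (c * (l - r)); [ring | by rewrite H subrr mulr0]
  end.
Ltac vring := functionals; ring.
Ltac vfield := functionals; field; by do ?[apply/andP; split].

(** Polarization: 2 ab = (a + b)^2 - a^2 - b^2. Linearity is a hypothesis so that [F] and [G] can be
    arbitrary expressions in their argument. *)
Lemma sym2_ext_sq (k : fieldType) (V U : vectType k) (F G : sym2 V -> U) :
  2%:R != 0 :> k -> linear F -> linear G ->
  (forall v, F (v \s* v) = G (v \s* v)) -> F =1 G.
Proof.
move=> n2 lF lG FG t; rewrite -(linfunE lF) -(linfunE lG).
apply: sym2_ext => a b /=.
have sq v : linfun F (v \s* v) = linfun G (v \s* v) by rewrite !linfunE.
have := sq (a + b); rewrite linearDl !linearDr /= [b \s* a]sprodC !linearD /=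
  !sq.
rewrite -!addrA => /addrI; rewrite !addrA => /addIr.
rewrite -!mulr2n -!scaler_nat => /(congr1 (fun x => 2^-1 *: x)).
by rewrite !scalerA mulVf // !scale1r.
Qed.

Ltac vlincomb c H := apply: subr0_eq;
  match type of H with
  | ?l = ?r => transitivity (c *: (l - r)); [vring | by rewrite H subrr scaler0]
  end.

(** * Cross products and their traces *)

Section CrossProduct.

Variables (k : fieldType) (W : vectType k).
Variables (dot : W -> W -> k) (cross : W -> W -> W) (n : nat) (e f : 'I_n -> W).

Hypotheses (n2 : 2%:R != 0 :> k) (n3 : 3%:R != 0 :> k).
Hypothesis dotC : forall a b, dot a b = dot b a.
Hypothesis dotP : forall c a b d, dot (c *: a + b) d = c * dot a d + dot b d.
Hypothesis crossP : forall c a b d, cross (c *: a + b) d = c *: cross a d +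
  cross b d.
Hypothesis crossC : forall a b, cross a b = - cross b a.
Hypothesis dot_cross : forall a b c, dot (cross a b) c = dot a (cross b c).
Hypothesis cross_cross : forall a b c, cross a (cross b c) =
  - cross b (cross a c) + dot a c *: b + dot b c *: a - (2 * dot a b) *: c.
Hypothesis dual_basis : forall x, x = \sum_i dot (f i) x *: e i.

Implicit Types (a b c u v w x y z : W).

Lemma dotDl a b c : dot (a + b) c = dot a c + dot b c.
Proof. by have := dotP 1 a b c; rewrite scale1r mul1r. Qed.

Lemma dot0l c : dot 0 c = 0.
Proof. by have := dotDl 0 0 c; rewrite addr0 -{1}[dot 0 c]addr0 => /addrI. Qed.

Lemma dotZl t a c : dot (t *: a) c = t * dot a c.
Proof. by have := dotP t a 0 c; rewrite addr0 dot0l addr0. Qed.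

Lemma dotNl a c : dot (- a) c = - dot a c.
Proof. by rewrite -scaleN1r dotZl mulN1r. Qed.

Lemma dotDr a b c : dot c (a + b) = dot c a + dot c b.
Proof. by rewrite !(dotC c) dotDl. Qed.

Lemma dot0r c : dot c 0 = 0. Proof. by rewrite dotC dot0l. Qed.

Lemma dotZr t a c : dot c (t *: a) = t * dot c a.
Proof. by rewrite !(dotC c) dotZl. Qed.

Lemma dotNr a c : dot c (- a) = - dot c a.
Proof. by rewrite !(dotC c) dotNl. Qed.

Lemma crossDl a b c : cross (a + b) c = cross a c + cross b c.
Proof. by have := crossP 1 a b c; rewrite !scale1r. Qed.

Lemma cross0l c : cross 0 c = 0.
Proof. by have := crossDl 0 0 c; rewrite addr0 -{1}[cross 0 c]addr0 => /addrI.
  Qed.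

Lemma crossZl t a c : cross (t *: a) c = t *: cross a c.
Proof. by have := crossP t a 0 c; rewrite addr0 cross0l addr0. Qed.

Lemma crossNl a c : cross (- a) c = - cross a c.
Proof. by rewrite -scaleN1r crossZl scaleN1r. Qed.

Lemma crossDr a b c : cross c (a + b) = cross c a + cross c b.
Proof. by rewrite crossC crossDl opprD -!(crossC c). Qed.

Lemma crossZr t a c : cross c (t *: a) = t *: cross c a.
Proof. by rewrite crossC crossZl -scalerN -crossC. Qed.

Lemma crossNr a c : cross c (- a) = - cross c a.
Proof. by rewrite -scaleN1r crossZr scaleN1r. Qed.

Definition linE := (dotDl, dotNl, dotZl, dotDr, dotNr, dotZr,
  crossDl, crossNl, crossZl, crossDr, crossNr, crossZr).

Lemma dot_suml (I : finType) (F : I -> W) y :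
  dot (\sum_i F i) y = \sum_i dot (F i) y.
Proof. exact: (big_morph (dot^~ y) (fun a b => dotDl a b y) (dot0l y)). Qed.

Lemma dot_sumr (I : finType) (F : I -> W) y :
  dot y (\sum_i F i) = \sum_i dot y (F i).
Proof. by rewrite dotC dot_suml; apply: eq_bigr => i _; rewrite dotC. Qed.

Lemma dot_nondeg x y : (forall z, dot z x = dot z y) -> x = y.
Proof.
by move=> xy; rewrite [x]dual_basis [y]dual_basis; apply: eq_bigr => i _;
  rewrite xy.
Qed.

Lemma dual_basisC x : x = \sum_i dot (e i) x *: f i.
Proof.
apply: dot_nondeg => z; rewrite {1}[z]dual_basis dot_suml dot_sumr.
by apply: eq_bigr => i _; rewrite dotZl dotZr mulrC dotC mulrC [dot z _]dotC
  mulrC.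
Qed.

(* Operators on W are plain functions; tr is a trace on the linear ones. *)
Definition tr (g : W -> W) : k := \sum_i dot (f i) (g (e i)).

Lemma eq_tr g h : g =1 h -> tr g = tr h.
Proof. by move=> gh; apply: eq_bigr => i _; rewrite gh. Qed.

Lemma trD g h : tr (fun x => g x + h x) = tr g + tr h.
Proof. by rewrite -big_split; apply: eq_bigr => i _; rewrite dotDr. Qed.

Lemma trZ (t : k) g : tr (fun x => t *: g x) = t * tr g.
Proof. by rewrite mulr_sumr; apply: eq_bigr => i _; rewrite dotZr. Qed.

Lemma trN g : tr (fun x => - g x) = - tr g.
Proof. by rewrite -sumrN; apply: eq_bigr => i _; rewrite dotNr. Qed.

Lemma tr_sub g h : tr (fun x => g x - h x) = tr g - tr h.
Proof. by rewrite trD trN. Qed.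

Let lin_expand (g : W -> W) x : linear g -> g x = \sum_i dot (f i) x *: g (e i).
Proof.
move=> lg; rewrite -(linfunE lg) {1}[x]dual_basis linear_sum.
by apply: eq_bigr => i _; rewrite linearZ /= linfunE.
Qed.

Lemma tr_comp g h : linear g -> linear h ->
  tr (fun x => g (h x)) = tr (fun x => h (g x)).
Proof.
move=> lg lh; rewrite /tr.
under eq_bigr => i _ do rewrite (lin_expand _ lg) dot_sumr.
rewrite exchange_big; apply: eq_bigr => j _; rewrite (lin_expand _ lh) dot_sumr.
by apply: eq_bigr => i _; rewrite !dotZr mulrC.
Qed.

Lemma tr_dyad u v : tr (fun x => dot u x *: v) = dot u v.
Proof.
rewrite [in RHS](dual_basis v) dot_sumr; apply: eq_bigr => i _.
by rewrite !dotZr mulrC.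
Qed.

Lemma tr_dyad_comp g u v : linear g -> tr (fun x => dot u (g x) *: v) = dot u
  (g v).
Proof.
move=> lg; rewrite (@tr_comp (fun x => dot u x *: v)) //; last first.
  by move=> t x y; rewrite !linE; vring.
by rewrite -tr_dyad; apply: eq_tr => x; rewrite -!(linfunE lg) linearZ.
Qed.

Lemma tr_adj g h : linear h -> (forall x y, dot (g x) y = dot x (h y)) -> tr g =
  tr h.
Proof.
move=> lh gh; rewrite /tr.
under eq_bigr => i _ do rewrite dotC gh (lin_expand _ lh) dot_sumr.
rewrite exchange_big; apply: eq_bigr => j _.
rewrite {2}[f j]dual_basis dot_suml; apply: eq_bigr => i _.
by rewrite dotZl dotZr [dot (f i) _]dotC.
Qed.

Hypothesis tr_id : tr id = 7%:R.

(* Moves A_u around the trace: A_v Q A_u = A_v A_u Q + A_v [Q, A_u]. *)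
Lemma pull_cross Q u v : linear Q ->
  2 * tr (fun x => cross u (cross v (Q x))) =
  dot v (Q u) + dot u (Q v) - 2 * dot u v * tr Q +
  tr (fun x => cross v (Q (cross u x)) - cross v (cross u (Q x))).
Proof.
move=> lQ; rewrite mulr_natl mulr2n.
rewrite {2}(eq_tr (fun x => cross_cross u v (Q x))).
rewrite !(trD, trN) !tr_dyad_comp // (trZ (2 * dot u v)).
rewrite (@tr_comp (cross u) (fun x => cross v (Q x))); first by ring.
  by move=> t x y; rewrite !linE.
by move=> t x y; rewrite lQ !linE.
Qed.

(** [pull_cross] with Q = id, where the commutator vanishes, gives the factor 2 - 2 . 7 = 2 .
    (-6). *)
Lemma tr_cross_cross u v : tr (fun x => cross u (cross v x)) = - 6 * dot u v.
Proof.
apply: (mulfI n2); rewrite (@pull_cross id) // tr_id.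
rewrite (eq_tr (h := fun x => 0 *: x)); first by rewrite (trZ 0 id)
  [dot v u]dotC; ring.
by move=> x; rewrite subrr scale0r.
Qed.

Lemma cross_cross_l u v x : cross (cross u v) x =
  - cross u (cross v x) - dot v x *: u - dot u v *: x + 2 *: (dot u x *: v).
Proof.
rewrite crossC cross_cross [cross x v]crossC [dot x v]dotC [dot x u]dotC !linE;
  vring.
Qed.

(* D_{u,v} as a function of its argument *)
Definition inn_fun u v x := dot u x *: v - dot v x *: u - 3^-1 *: cross
  (cross u v) x.

(* The 4-fold product u x (v x (x x y)) is antisymmetric up to shorter terms,
   but the exchange of (u, v) with (x, y) changes the sign of
   (u x v) x (x x y), whence the formula for the latter. *)
Lemma cross_cross_cross u v x y : cross (cross u v) (cross x y) =
  dot u (cross x y) *: v - dot v (cross x y) *: u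
  - dot (cross u v) x *: y + dot (cross u v) y *: x
  - dot u x *: cross v y + dot v x *: cross u y + dot u y *: cross v x - dot v y
    *: cross u x.
Proof.
apply: (scalerI n2); rewrite scaler_nat mulr2n {2}crossC !cross_cross_l.
rewrite (cross_cross y u v) !linE (cross_cross x u) [cross y v]crossC !linE
  (cross_cross x v) !linE.
have -> : dot x (cross v y) = - dot v (cross x y) by rewrite -!dot_cross
  [cross x v]crossC dotNl.
rewrite -[dot u (cross v y)]dot_cross [dot y (cross u v)]dotC
  [dot x (cross u v)]dotC.
rewrite [cross x u]crossC [cross x v]crossC [dot y v]dotC [dot y u]dotC
  [dot x v]dotC [dot x u]dotC; vring.
Qed.

(** For any w, the defect of A_w in the derivation rule is 3 (w x (x x y) + (w, x) y - (w, y) x).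
    For w = u x v, [cross_cross_cross] identifies the bracket with the defect of v u^T - u v^T, so
    that subtracting A_w / 3 cancels it. *)
Lemma inn_fun_cross u v x y :
  inn_fun u v (cross x y) = cross (inn_fun u v x) y + cross x (inn_fun u v y).
Proof.
rewrite /inn_fun !linE (cross_cross_l (cross u v) x y)
  (cross_cross x (cross u v) y) !cross_cross_cross.
by rewrite [cross x v]crossC [cross x u]crossC [dot x (cross u v)]dotC; vfield.
Qed.

Lemma inn_fun_skew u v x y : dot (inn_fun u v x) y = - dot x (inn_fun u v y).
Proof.
have -> : inn_fun u v x = dot u x *: v - dot v x *: u + 3^-1 *: cross x
  (cross u v).
  by rewrite /inn_fun [cross _ x]crossC; vring.
by rewrite /inn_fun !linE dot_cross [dot x v]dotC [dot x u]dotC; ring.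
Qed.

Lemma inn_fun_linear u v : linear (inn_fun u v).
Proof. by move=> t x y; rewrite /inn_fun !linE; vring. Qed.

(** * Traces of derivations *)

Variables (L : lieAlgebra k) (act : L -> W -> W).
Hypothesis actP : forall X (t : k) a b, act X (t *: a + b) = t *: act X a + act
  X b.
Hypothesis act_cross : forall X a b, act X (cross a b) = cross (act X a) b +
  cross a (act X b).
Hypothesis act_skew : forall X a b, dot (act X a) b = - dot a (act X b).

Implicit Types (X Y Z V : L).

Lemma actDr X a b : act X (a + b) = act X a + act X b.
Proof. by have := actP X 1 a b; rewrite !scale1r. Qed.

Lemma act0r X : act X 0 = 0.
Proof. by have := actDr X 0 0; rewrite addr0 -{1}[act X 0]addr0 => /addrI. Qed.

Lemma actZr X t a : act X (t *: a) = t *: act X a.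
Proof. by have := actP X t a 0; rewrite !addr0 act0r addr0. Qed.

Lemma actNr X a : act X (- a) = - act X a.
Proof. by rewrite -scaleN1r actZr scaleN1r. Qed.

Lemma act_sumr X (I : finType) (F : I -> W) :
  act X (\sum_i F i) = \sum_i act X (F i).
Proof. exact: (big_morph (act X) (actDr X) (act0r X)). Qed.

Definition actE := (actDr, actZr, actNr).

Lemma tr_act X : tr (act X) = 0.
Proof.
have /eqP : tr (act X) = - tr (act X).
  rewrite -[RHS]trN; apply: tr_adj => [t x y|x y].
    by rewrite !actE; vring.
  by rewrite act_skew dotNr.
by rewrite -subr_eq0 opprK -mulr2n -mulr_natl mulf_eq0 (negPf n2) => /eqP.
Qed.

Lemma tr_act2C X Y : tr (fun x => act X (act Y x)) = tr
  (fun x => act Y (act X x)).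
Proof. by apply: tr_comp => t x y; rewrite actP. Qed.

(** As [X, A_u] = A_{X u} for a derivation X, [pull_cross] expresses the trace of A_u A_v Q, for a
    word Q in derivations, by such traces with shorter words. The next lemmas do the same for words
    of length two and three. *)
Lemma tr_cross_cross_act u v X :
  tr (fun x => cross u (cross v (act X x))) = 3 * dot u (act X v).
Proof.
apply: (mulfI n2); rewrite (pull_cross _ _ (actP X)) tr_act.
rewrite [X in _ + X](eq_tr (h := fun x => cross v (cross (act X u) x))); last
  first.
  by move=> x; rewrite act_cross !linE; vring.
rewrite tr_cross_cross [dot v _]dotC act_skew; ring.
Qed.


Lemma tr_cross_cross_act2 u v X Y :
  tr (fun x => cross u (cross v (act X (act Y x)))) =
  2 * dot u (act X (act Y v)) - dot u (act Y (act X v))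
  - dot u v * tr (fun x => act X (act Y x)).
Proof.
apply: (mulfI n2); rewrite pull_cross; last by move=> t x y; rewrite !actE.
rewrite [X in _ + X](eq_tr (h := fun x => cross v (cross (act X (act Y u)) x)
   + cross v (cross (act Y u) (act X x)) + cross v
     (cross (act X u) (act Y x)))); last first.
  by move=> x; rewrite !(act_cross, actE, linE); vring.
rewrite !trD tr_cross_cross !tr_cross_cross_act ![dot v _]dotC
  !(act_skew, linE); ring.
Qed.

Let tr_cross_cross_act3 u v X Y V :
  2 * tr (fun x => cross u (cross v (act X (act Y (act V x))))) =
  dot v (act X (act Y (act V u))) + dot u (act X (act Y (act V v)))
  - 2 * dot u v * tr (fun x => act X (act Y (act V x))) +
  (tr (fun x => cross v (cross (act X u) (act Y (act V x))))
  + tr (fun x => cross v (cross (act Y u) (act X (act V x))))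
  + tr (fun x => cross v (cross (act V u) (act X (act Y x))))
  + tr (fun x => cross v (cross (act X (act Y u)) (act V x)))
  + tr (fun x => cross v (cross (act X (act V u)) (act Y x)))
  + tr (fun x => cross v (cross (act Y (act V u)) (act X x)))
  + tr (fun x => cross v (cross (act X (act Y (act V u))) x))).
Proof.
rewrite pull_cross; last by move=> t x y; rewrite !actE.
rewrite -!trD; congr (_ + _); apply: eq_tr => x.
by rewrite !(act_cross, actE, linE); vring.
Qed.

(** Expanding A_{u x v} by [cross_cross_l] leaves (-3 + 1 + 2) (u, X v). *)
Lemma tr_cross_prod_act u v X : tr (fun x => cross (cross u v) (act X x)) = 0.
Proof.
rewrite (eq_tr (fun x => cross_cross_l u v (act X x))).
rewrite !(trD, trN) tr_cross_cross_act (trZ 2) (trZ (dot u v)).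
rewrite !(tr_dyad_comp _ _ (actP X)) tr_act [dot v _]dotC act_skew; ring.
Qed.

Let inn_funE u v x :
  3 *: inn_fun u v x = dot u x *: v - 2 *: (dot v x *: u) + cross u (cross v x)
    + dot u v *: x.
Proof.
rewrite /inn_fun cross_cross_l; vfield.
Qed.

(** A_{u x v} is orthogonal to g, hence D_{u,v} pairs with g as v u^T - u v^T does: it is the
    projection of that operator on g. *)
Lemma tr_inn_act u v X : tr (fun x => inn_fun u v (act X x)) = 2 * dot u
  (act X v).
Proof.
rewrite /inn_fun !tr_sub (trZ 3^-1) tr_cross_prod_act
  !(tr_dyad_comp _ _ (actP X)).
rewrite [dot v _]dotC act_skew; ring.
Qed.

(** The factor 6 clears the 1/3 of D_{u,v} and the 1/2 of [pull_cross]. The last bracket is what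
    [tr_cross_cross_act3] expresses by shorter words. *)
Let tr_inn_act3 u v X Y V (w := fun x => act X (act Y (act V x))) :
  6 * tr (fun x => inn_fun u v (w x)) = 3 * dot u (w v) - 3 * dot v (w u)
  + (2 * tr (fun x => cross u (cross v (w x))) -
   (dot v (w u) + dot u (w v) - 2 * dot u v * tr w)).
Proof.
have lw : linear w by move=> t x y; rewrite /w !actE.
rewrite (_ : 6%:R = 2 * 3%:R); last by rewrite -natrM.
rewrite -mulrA -(trZ 3) (eq_tr (fun x => inn_funE u v (w x))).
rewrite !(tr_sub, trD) (trZ (dot u v)) (trZ 2) !tr_dyad_comp //; ring.
Qed.

(** The case Z = D_{u,v} of the quartic identity [tr_quartic]: all traces reduce to scalars (u, w
    v), with w a word in X and V, and to traces of two derivations. *)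
Let quartic_inn u v X V (Z := inn_fun u v) :
  4 * (tr (fun x => Z (act X (act X (act V x))))
     + tr (fun x => Z (act V (act X (act X x))))
     + tr (fun x => Z (act X (act V (act X x))))) =
  tr (fun x => act X (act X x)) * tr (fun x => Z (act V x))
  + 2 * tr (fun x => Z (act X x)) * tr (fun x => act X (act V x)).
Proof.
apply: (mulfI n3); rewrite /Z !tr_inn_act.
have E (a b d : k) : 3 * (4 * (a + b + d)) = 2 * (6 * a + 6 * b + 6 * d) by
  ring.
rewrite E !tr_inn_act3 /= !tr_cross_cross_act3 !tr_cross_cross_act2
  !tr_cross_cross_act !tr_cross_cross.
rewrite (tr_act2C V X) ![dot v _]dotC !(act_skew, linE).
ring.
Qed.


Lemma cross_suml (I : finType) (F : I -> W) y :
  cross (\sum_i F i) y = \sum_i cross (F i) y.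
Proof. exact: (big_morph (cross^~ y) (fun a b => crossDl a b y) (cross0l y)).
  Qed.

(** * The operators D_{u,v} span the derivations *)

Hypothesis act_linear : forall (t : k) X Y a, act (t *: X + Y) a = t *: act X a
  + act Y a.
Hypothesis act_br : forall X Y a, act (lie_br X Y) a = act X (act Y a) - act Y
  (act X a).
Hypothesis act_inj : forall X Y, act X =1 act Y -> X = Y.
Variable inn : W -> W -> L.
Hypothesis act_inn : forall u v x, act (inn u v) x = inn_fun u v x.

Lemma actDl X Y a : act (X + Y) a = act X a + act Y a.
Proof. by have := act_linear 1 X Y a; rewrite !scale1r. Qed.

Lemma act0l a : act 0 a = 0.
Proof. by have := actDl 0 0 a; rewrite addr0 -{1}[act 0 a]addr0 => /addrI. Qed.

Lemma actZl t X a : act (t *: X) a = t *: act X a.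
Proof. by have := act_linear t X 0 a; rewrite !addr0 act0l addr0. Qed.

Lemma actNl X a : act (- X) a = - act X a.
Proof. by rewrite -scaleN1r actZl scaleN1r. Qed.

Definition actlE := (actDl, actZl, actNl).

Lemma act_suml (I : finType) (F : I -> L) a :
  act (\sum_i F i) a = \sum_i act (F i) a.
Proof. exact: (big_morph (act^~ a) (fun X Y => actDl X Y a) (act0l a)). Qed.

Lemma inn_linearl v : linear (inn^~ v).
Proof.
move=> t u u'; apply: act_inj => x.
by rewrite !(actlE, act_inn) /inn_fun !linE; vring.
Qed.

Lemma inn_linearr u : linear (inn u).
Proof.
move=> t v v'; apply: act_inj => x.
by rewrite !(actlE, act_inn) /inn_fun !linE; vring.
Qed.

Lemma sum_dot_dual : \sum_i dot (e i) (f i) = 7%:R.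
Proof. by rewrite -tr_id; apply: eq_bigr => i _; rewrite dotC. Qed.

Lemma tr_cross_act z X : tr (fun x => cross z (act X x)) = 0.
Proof.
(* Every z is a combination of cross products, since the right side pairs with y to tr(A_z A_y);
   this reduces the claim to [tr_cross_prod_act]. *)
have z_sum : - 6 *: z = \sum_i cross (e i) (cross (f i) z).
  apply: dot_nondeg => y; rewrite dot_sumr dotZr dotC -tr_cross_cross; apply:
    eq_bigr => i _.
  by rewrite -!dot_cross dot_cross [RHS]dot_cross dotC.
have n6 : - 6%:R != 0 :> k by rewrite oppr_eq0 (natrM _ 2 3) mulf_neq0.
apply: (mulfI n6); rewrite mulr0 -trZ.
under eq_tr => x do rewrite -crossZl z_sum cross_suml.
rewrite /tr; under eq_bigr => i _ do rewrite dot_sumr.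
rewrite exchange_big big1 // => j _; exact: tr_cross_prod_act.
Qed.

Lemma sum_cross_act X : \sum_i cross (e i) (act X (f i)) = 0.
Proof.
apply: dot_nondeg => z; rewrite dot_sumr dot0r -[RHS]oppr0
  -[in RHS](tr_cross_act z X).
rewrite (tr_comp (g := cross z)) ?[in RHS]sumrN -?sumrN; last 2 first.
- by move=> t x y; rewrite !linE.
- exact: actP.
by apply: eq_bigr => i _; rewrite -dot_cross dotC act_skew.
Qed.


(** The parts v u^T - u v^T add up to X - X^T = 2 X, and the corrections to a multiple of A_z with z
    the sum of the e_i x X f_i, which is 0 by [sum_cross_act]. *)
Lemma inn_span X : X = 2^-1 *: \sum_i inn (e i) (act X (f i)).
Proof.
apply: act_inj => x; rewrite actZl act_suml.
under eq_bigr => i _ do rewrite act_inn /inn_fun.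
rewrite !sumrB -scaler_sumr -cross_suml sum_cross_act cross0l scaler0 subr0
  -sumrN -big_split /=.
rewrite (_ : \sum_i _ = act X x + act X x).
  by rewrite -mulr2n -scaler_nat scalerA mulVf // scale1r.
rewrite big_split /=; congr (_ + _).
  rewrite [in RHS](dual_basisC x) act_sumr.
  by apply: eq_bigr => i _; rewrite actZr.
rewrite [RHS]dual_basis; apply: eq_bigr => i _.
by rewrite act_skew scaleNr opprK.
Qed.

Lemma tr_act_inn (g : W -> W) X : tr (fun x => act X (g x)) =
  2^-1 * \sum_i tr (fun x => inn_fun (e i) (act X (f i)) (g x)).
Proof.
rewrite exchange_big mulr_sumr; apply: eq_bigr => j _.
rewrite {1}[X]inn_span actZl dotZr act_suml dot_sumr; congr (_ * _).
by apply: eq_bigr => i _; rewrite act_inn.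
Qed.

(* The polarization of 4 tr(X^4) = tr(X^2)^2, the absence of an independent
   quartic invariant on g. *)
Lemma tr_quartic X Z V :
  4 * (tr (fun x => act Z (act X (act X (act V x))))
     + tr (fun x => act Z (act V (act X (act X x))))
     + tr (fun x => act Z (act X (act V (act X x))))) =
  tr (fun x => act X (act X x)) * tr (fun x => act Z (act V x))
  + 2 * tr (fun x => act Z (act X x)) * tr (fun x => act X (act V x)).
Proof.
rewrite !(tr_act_inn _ Z).
have El (h a b c : k) : 4 * (h * a + h * b + h * c) = h * (4 * (a + b + c)) by
  ring.
have Er (h a b c d : k) : a * (h * b) + 2 * (h * c) * d = h *
  (a * b + 2 * c * d).
  by ring.
rewrite El Er; congr (_ * _); rewrite -!big_split /=.
rewrite [LHS]mulr_sumr [X in _ = X + _]mulr_sumr [2 * _]mulr_sumr mulr_suml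
  -big_split.
by apply: eq_bigr => i _; rewrite /= quartic_inn.
Qed.

(** Taking V = D_{u,v} recovers the matrix entries 2 (u, X v). *)
Lemma tr_act_nondeg X Y :
  (forall V, tr (fun x => act X (act V x)) = tr (fun x => act Y (act V x))) -> X
    = Y.
Proof.
move=> XY; apply: act_inj => v; apply: dot_nondeg => u; apply: (mulfI n2).
rewrite -!tr_inn_act; have := XY (inn u v); rewrite !(tr_act2C _ (inn u v)).
by rewrite !(eq_tr (fun x => act_inn u v (act _ x))).
Qed.

(** * The Killing form *)

Lemma lftrace_comp (U V : vectType k) (g : 'Hom(U, V)) (h : 'Hom(V, U)) :
  lftrace (g \o h) = lftrace (h \o g).
Proof. by rewrite /lftrace !(passmx.mxof_comp _ _ (vbasisP _)) mxtrace_mulC.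
  Qed.

Hypothesis lftrace_tr : forall g : 'End(W), lftrace g = tr g.

(* The trace on L of g, from the decomposition inn_span of the identity of L
   through W. *)
Lemma lftrace_inn (g : 'End(L)) :
  lftrace g = 2^-1 * \sum_i tr (fun w => act (g (inn (e i) w)) (f i)).
Proof.
pose al i : 'Hom(W, L) := linfun (inn (e i)).
pose be i : 'Hom(L, W) := linfun (fun X => act X (f i)).
have beE i X : be i X = act X (f i).
  by rewrite /be linfunE // => t Y Z; rewrite act_linear.
have {1}-> : g = 2^-1 *: \sum_i ((g \o al i) \o be i)%VF.
  apply/lfunP => X; rewrite {1}[X]inn_span scale_lfunE linearZ sum_lfunE
    linear_sum /=.
  congr (_ *: _); apply: eq_bigr => i _; rewrite !comp_lfunE beE linfunE //.
  exact: inn_linearr.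
rewrite linearZ linear_sum /=; congr (_ * _); apply: eq_bigr => i _.
rewrite lftrace_comp lftrace_tr; apply: eq_tr => w.
rewrite !comp_lfunE beE linfunE //; exact: inn_linearr.
Qed.

Let tr_inn_comp a b Q : linear Q ->
  3 * tr (fun w => inn_fun a (Q w) b) =
  3 * dot a b * tr Q - 3 * dot b (Q a) + tr (fun w => cross b (cross a (Q w))).
Proof.
move=> lQ; rewrite -trZ.
rewrite (eq_tr (h := fun w => 3 * dot a b *: Q w - 3 *: (dot b (Q w) *: a) +
  cross b (cross a (Q w)))).
  by rewrite trD tr_sub (trZ (3 * dot a b)) (trZ 3) tr_dyad_comp.
move=> w; rewrite /inn_fun [cross (cross _ _) _]crossC [dot (Q w) b]dotC;
  vfield.
Qed.

Let tr_inn_id a b :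
  3 * tr (fun w => inn_fun a w b) = 3 * dot a b * 7 - 3 * dot b a - 6 * dot b a.
Proof. by rewrite (@tr_inn_comp a b id) // tr_cross_cross tr_id mulNr. Qed.

(** In [lftrace_inn] the operator [X, [Y, D]] with D = D_{e_i, w} is the sum of words X Y D - X D Y
    - Y D X + D Y X, and the trace over w of each word at f_i is known from [tr_inn_comp]. *)
Lemma killing_tr X Y : killing X Y = 4 * tr (fun x => act X (act Y x)).
Proof.
set t := tr _; have n6 : 6%:R != 0 :> k by rewrite (natrM _ 2 3) mulf_neq0.
have inn_lin a b : linear (fun w => inn_fun a w b).
  by move=> c w w'; rewrite -!act_inn inn_linearr act_linear.
have actC Z a b Q : linear Q -> tr (fun w => act Z (inn_fun a (Q w) b)) =
    tr (fun w => inn_fun a (Q (act Z w)) b).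
  move=> lQ; apply: (@tr_comp (act Z) (fun w => inn_fun a (Q w) b)) =>
    [|c w w'].
    exact: actP.
  by rewrite lQ inn_lin.
have actl Z : linear (act Z) by exact: actP.
apply: (mulfI n6); rewrite /killing lftrace_inn.
have -> (x : k) : 6 * (2^-1 * x) = 3 * x by field.
rewrite mulr_sumr.
have E i : 3 * tr (fun w => act ((ad X \o ad Y)%VF (inn (e i) w)) (f i)) =
    2 * dot (e i) (f i) * t + 11 * dot (f i) (act X (act Y (e i)))
    - dot (f i) (act Y (act X (e i))).
  rewrite (eq_tr (h := fun w => act X (act Y (inn_fun (e i) w (f i)))
    - act X (inn_fun (e i) w (act Y (f i))) - act Y
      (inn_fun (e i) w (act X (f i)))
    + inn_fun (e i) w (act Y (act X (f i))))); last first.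
    by move=> w; rewrite comp_lfunE !adE !act_br !act_inn !actE; vring.
  rewrite trD 2!tr_sub (actC X _ _ id) // (actC Y _ _ id) //.
  rewrite (@tr_comp (act X) (fun w => act Y (inn_fun (e i) w (f i)))) //; last
    first.
    by move=> c w w'; rewrite inn_lin actP.
  rewrite (actC Y _ _ (act X)) // mulrDr !mulrBr.
  rewrite (@tr_inn_comp _ _ (fun w => act X (act Y w))); last by move=> c w w';
    rewrite !actE.
  rewrite (tr_inn_comp _ _ (actl X)) (tr_inn_comp _ _ (actl Y)) tr_inn_id.
  rewrite tr_cross_cross_act2 !tr_cross_cross_act !tr_act -/t.
  rewrite [dot (e i) (act Y (act _ _))]dotC !(act_skew, linE)
    [dot (e i) (f i)]dotC; ring.
(* Summing over i gives 2 . 7 + 11 - 1 = 24 = 6 . 4 times the trace. *)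
rewrite (eq_bigr _ (fun i _ => E i)) sumrB big_split /= -mulr_suml -!mulr_sumr.
rewrite sum_dot_dual -[\sum_i dot _ _]/t -[\sum_i dot _ _]/(tr
  (fun x => act Y (act X x))).
rewrite (tr_act2C Y X) -/t; ring.
Qed.


(** * The symmetric square of W *)

Let half_double (V : lmodType k) (v : V) : 2^-1 *: (v + v) = v.
Proof. by rewrite -mulr2n -scaler_nat scalerA mulVf // scale1r. Qed.

Definition op : 'Hom(sym2 W, 'End(W)) :=
  sym2_lift (fun a b => linfun (fun x => 2^-1 *:
    (dot b x *: a + dot a x *: b))).

Let op_lin a b : linear (fun x => 2^-1 *: (dot b x *: a + dot a x *: b)).
Proof. by move=> t x y; rewrite !linE; vring. Qed.

Lemma opE a b x : op (a \s* b) x = 2^-1 *: (dot b x *: a + dot a x *: b).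
Proof.
rewrite /op sym2_liftE ?linfunE //.
  split=> u t v w; apply/lfunP=> y.
    rewrite add_lfunE scale_lfunE !linfunE // !linE; vring.
  by rewrite add_lfunE scale_lfunE !linfunE // !linE; vring.
by move=> u v; apply/lfunP=> y; rewrite !linfunE // addrC.
Qed.

Lemma op_sq u x : op (u \s* u) x = dot u x *: u.
Proof. by rewrite opE half_double. Qed.

Lemma op_sym p x y : dot (op p x) y = dot x (op p y).
Proof.
have ll : linear (fun p => dot (op p x) y : k^o).
  by move=> t q r; rewrite linearP add_lfunE scale_lfunE !linE.
have lr : linear (fun p => dot x (op p y) : k^o).
  by move=> t q r; rewrite linearP add_lfunE scale_lfunE !linE.
apply: (sym2_ext_sq n2 ll lr) => u.
by rewrite !op_sq !linE [dot x u]dotC mulrC.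
Qed.

(* the inverse of op on the self-adjoint operators *)
Definition sym_of (g : W -> W) : sym2 W := \sum_i g (e i) \s* f i.

Lemma sym_of_linear t g h :
  sym_of (fun x => t *: g x + h x) = t *: sym_of g + sym_of h.
Proof.
by rewrite scaler_sumr -big_split; apply: eq_bigr => i _; rewrite linearPl.
Qed.

Lemma eq_sym_of g h : g =1 h -> sym_of g = sym_of h.
Proof. by move=> gh; apply: eq_bigr => i _; rewrite gh. Qed.

Lemma sym_of_op p : sym_of (op p) = p.
Proof.
have ll : linear (fun p => sym_of (op p)).
  move=> t q r; rewrite -sym_of_linear; apply: eq_sym_of => x.
  by rewrite linearP add_lfunE scale_lfunE.
apply: (sym2_ext_sq n2 ll (G := id)) => // u.
rewrite [X in _ = _ X](dual_basisC u) linear_sumr; apply: eq_bigr => i _.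
by rewrite op_sq linearZl_LR linearZr_LR /= dotC.
Qed.

Lemma op_inj p q : op p =1 op q -> p = q.
Proof. by move=> pq; rewrite -(sym_of_op p) (eq_sym_of pq) sym_of_op. Qed.

Lemma op_sym_of g : linear g -> (forall x y, dot (g x) y = dot x (g y)) ->
  op (sym_of g) =1 g.
Proof.
move=> lg sg x; rewrite linear_sum sum_lfunE.
under eq_bigr => i _ do rewrite opE sg.
rewrite -scaler_sumr big_split /= -(dual_basisC (g x)) -(lin_expand x lg).
by rewrite half_double.
Qed.

(** The polarization of T(X^2) = 12 X^2 - tr(X^2), as an operator on W. *)
Let tmap_fun X Y x :=
  6 *: (act X (act Y x) + act Y (act X x)) - tr (fun x => act X (act Y x)) *: x.

Definition tmap : 'Hom(sym2 L, sym2 W) :=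
  sym2_lift (fun X Y => sym_of (tmap_fun X Y)).

Let tmapE X Y : tmap (X \s* Y) = sym_of (tmap_fun X Y).
Proof.
rewrite /tmap sym2_liftE //; last first.
  by move=> U V; apply: eq_sym_of => x; rewrite /tmap_fun tr_act2C
    [_ + act V _]addrC.
split=> U t X' Y'; rewrite -sym_of_linear; apply: eq_sym_of => x.
  rewrite /tmap_fun (eq_tr (h := fun x => t *: act X' (act U x) + act Y'
    (act U x))).
    by rewrite trD trZ !(actE, act_linear); vring.
  by move=> y; rewrite act_linear.
rewrite /tmap_fun (eq_tr (h := fun x => t *: act U (act X' x) + act U
  (act Y' x))).
  by rewrite trD trZ !(actE, act_linear); vring.
by move=> y; rewrite act_linear !actE.
Qed.

Let op_tmapE X Y x : op (tmap (X \s* Y)) x = tmap_fun X Y x.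
Proof.
rewrite tmapE op_sym_of // /tmap_fun => [t y z|y z].
  by rewrite !actE; vring.
by rewrite !(linE, act_skew); ring.
Qed.

Lemma op_tmap X x : op (tmap (X \s* X)) x =
  12 *: act X (act X x) - tr (fun x => act X (act X x)) *: x.
Proof.
by rewrite op_tmapE /tmap_fun; vring. Qed.

Definition phi : 'Hom(sym2 W, 'End(L)) := sym2_lift (fun a b =>
  linfun (fun C => 2^-1 *: (inn a (act C b) + inn b (act C a)))).

Let phi_lin a b : linear (fun C => 2^-1 *: (inn a (act C b) + inn b (act C a))).
Proof.
by move=> t C D; rewrite !act_linear !inn_linearr; vring.
Qed.

Lemma phi_sq u C : phi (u \s* u) C = inn u (act C u).
Proof.
rewrite /phi sym2_liftE ?linfunE //.
- by rewrite half_double.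
- split=> v t a b; apply/lfunP=> D; rewrite add_lfunE scale_lfunE !linfunE //.
    by rewrite inn_linearl actP inn_linearr; vring.
  by rewrite inn_linearl actP inn_linearr; vring.
- by move=> a b; apply/lfunP=> D; rewrite !linfunE // addrC.
Qed.

(** This characterizes Phi(p) C as the projection of p C + C p on g. For p = u^2 both traces on the
    right equal (u, V C u), by skewness. *)
Lemma tr_phi p C V : tr (fun x => act (phi p C) (act V x)) =
  tr (fun x => op p (act C (act V x))) + tr (fun x => act C (op p (act V x))).
Proof.
pose F p : k^o := tr (fun x => act (phi p C) (act V x)).
pose G p : k^o := tr (fun x => op p (act C (act V x))) + tr
  (fun x => act C (op p (act V x))).
have lF : linear F.
  move=> t q r; have -> : t *: F q + F r = t * F q + F r by [].
  rewrite /F -trZ -trD; apply: eq_tr => x.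
  by rewrite linearP add_lfunE scale_lfunE act_linear.
have lG : linear G.
  move=> t q r; have -> : t *: G q + G r = t * G q + G r by [].
  rewrite /G -!trD -trZ -trD; apply: eq_tr => x.
  by rewrite linearP !(add_lfunE, scale_lfunE) !actE; vring.
rewrite -/(F p) -/(G p); apply: (sym2_ext_sq n2 lF lG) => u.
  rewrite /F /G phi_sq.
  rewrite (eq_tr (fun x => act_inn _ _ _)) tr_inn_act.
  rewrite [X in X + _](eq_tr (fun x => op_sq _ _)).
  rewrite [X in _ + X](eq_tr (h := fun x => dot u (act V x) *: act C u)); last
    first.
    by move=> x; rewrite op_sq actE.
  rewrite (tr_dyad_comp _ _ (actP V)).
  rewrite (@tr_dyad_comp (fun x => act C (act V x))); last first.
    by move=> t x y; rewrite !actE.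
  by rewrite [X in _ = X + _]dotC !act_skew opprK; ring.
Qed.

(** Both sides are tested on X^2, at Z, and against V by the nondegenerate trace form. On the left 4
    [X, [X, Z]] + K(X, Z) X gives words of degree four in X, X, Z, V, as does [tr_phi] on the right,
    and [tr_quartic] relates them. *)
Lemma cg_S_factor t : cg_S L 4 t = phi (tmap t).
Proof.
have lF : linear (fun t => cg_S L 4 t) by move=> a p q; rewrite linearP.
have lG : linear (fun t => phi (tmap t)) by move=> a p q; rewrite !linearP.
apply: (sym2_ext_sq n2 lF lG) => X; apply/lfunP => Z.
apply: tr_act_nondeg => V; rewrite tr_phi.
rewrite cg_S_sprod !(add_lfunE, scale_lfunE) killing_opE /bullet.
rewrite !(scale_lfunE, add_lfunE, comp_lfunE) !adE killing_tr.
set t2 := tr (fun x => act X (act Z x)).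
rewrite (eq_tr (h := fun x => 4 *: act X (act X (act Z (act V x)))
  - 8 *: act X (act Z (act X (act V x))) + 4 *: act Z (act X (act X (act V x)))
  + (4 * t2) *: act X (act V x))); last first.
  by move=> x; rewrite !(actlE, act_br, actE); vfield.
rewrite !(trD, tr_sub, trN) !trZ.
rewrite [X in _ = X + _](eq_tr (h := fun x => 12 *: act X
  (act X (act Z (act V x)))
  - tr (fun x => act X (act X x)) *: act Z (act V x))); last first.
  by move=> x; rewrite op_tmap.
rewrite [X in _ = _ + X](eq_tr (h := fun x => 12 *: act Z
  (act X (act X (act V x)))
  - tr (fun x => act X (act X x)) *: act Z (act V x))); last first.
  by move=> x; rewrite op_tmap !actE.
rewrite !tr_sub !trZ; have := tr_quartic X Z V.
rewrite (@tr_comp (fun x => act Z (act V x)) (fun x => act X (act X x))); last 2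
  first.
- by move=> c x y; rewrite !actE.
- by move=> c x y; rewrite !actE.
rewrite -(@tr_comp (act X) (fun x => act Z (act X (act V x)))); last 2 first.
- exact: actP.
- by move=> c x y; rewrite !actE.
(* The words X X Z V and Z X X V have coefficients 4 - 12 = -8 in the difference of the two sides,
   and X Z X V has -8 as well: this is -2 times [tr_quartic]. *)
by rewrite (tr_act2C Z X) -/t2 => H; lincomb (-2%:R : k) H.
Qed.

Definition actW C : 'End(sym2 W) :=
  sym2_lift (fun a b => act C a \s* b + a \s* act C b).

Let actWE C a b : actW C (a \s* b) = act C a \s* b + a \s* act C b.
Proof.
rewrite /actW sym2_liftE // => [|u v]; last by rewrite addrC; congr (_ + _);
  apply: sprodC.
by split=> u t v w; rewrite !actE !(linearPl, linearPr) /=; vring.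
Qed.

Lemma op_actW C p x : op (actW C p) x = act C (op p x) - op p (act C x).
Proof.
have lF : linear (fun p => op (actW C p) x).
  by move=> t q r; rewrite !linearP add_lfunE scale_lfunE.
have lG : linear (fun p => act C (op p x) - op p (act C x)).
  by move=> t q r; rewrite !linearP !add_lfunE !scale_lfunE !actE; vring.
apply: (sym2_ext_sq n2 lF lG) => u.
rewrite actWE linearD add_lfunE !op_sq !opE !actE act_skew; vfield.
Qed.

(** Equivariance of T: the commutator with C is a derivation of the product of operators, and the
    trace form is invariant. *)
Lemma tmap_actW C t : tmap (sym2_act C t) = actW C (tmap t).
Proof.
have lF : linear (fun t => tmap (sym2_act C t)) by move=> c q r; rewrite
  !linearP.
have lG : linear (fun t => actW C (tmap t)) by move=> c q r; rewrite !linearP.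
apply: (sym2_ext_sq n2 lF lG) => X; apply: op_inj => x.
rewrite op_actW !op_tmap sym2_actE [X \s* _]sprodC !linearD /= !add_lfunE.
rewrite op_tmapE /tmap_fun.
have -> : tr (fun x => act (lie_br C X) (act X x)) = 0.
  rewrite (eq_tr (fun x => act_br _ _ _)) tr_sub.
  rewrite (@tr_comp (act X) (fun x => act C (act X x))) ?subrr //.
    exact: actP.
  by move=> c y z; rewrite !actE.
by rewrite !(act_br, actE); vring.
Qed.

(** * Multiplicativity *)

Hypothesis n5 : 5%:R != 0 :> k.

Variable mul : 'Hom(sym2 W, 'Hom(sym2 W, sym2 W)).
Hypothesis mulE : forall u v, mul (u \s* u) (v \s* v) =
  6^-1 *: ((4 * dot u v) *: (u \s* v) + dot u u *: (v \s* v) + dot v v *: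
    (u \s* u)
           - cross u v \s* cross u v).

(** For Q = v v^T one has (v, v) = tr Q, and (u x v)^2 is the operator (A_u v) (A_u v)^T = - A_u Q
    A_u. The formula is therefore linear in Q. *)
Lemma op_mul_sq u q x (Q := op q) : op (mul (u \s* u) q) x =
  6^-1 *: (2 *: (dot u (Q x) *: u + dot u x *: Q u) + dot u u *: Q x
           + (tr Q * dot u x) *: u + cross u (Q (cross u x))).
Proof.
rewrite /Q {Q}.
pose G q := 6^-1 *: (2 *: (dot u (op q x) *: u + dot u x *: op q u)
  + dot u u *: op q x + (tr (op q) * dot u x) *: u + cross u
    (op q (cross u x))).
have lF : linear (fun q => op (mul (u \s* u) q) x).
  by move=> t q' r; rewrite !linearP add_lfunE scale_lfunE.
have lG : linear G.
  move=> t q' r; rewrite /G !linearP.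
  rewrite (eq_tr (h := fun x => t *: op q' x + op r x)) ?trD ?trZ; last first.
    by move=> y; rewrite add_lfunE scale_lfunE.
  by rewrite !add_lfunE !scale_lfunE !linE; vring.
rewrite -/(G q); apply: (sym2_ext_sq n2 lF lG) => v; rewrite /G mulE.
rewrite linearZ scale_lfunE; congr (_ *: _).
rewrite !linearD linearN !linearZ /= !(add_lfunE, scale_lfunE, opp_lfunE) !op_sq
  opE.
rewrite (eq_tr (fun x => op_sq v x)) tr_dyad -[dot v (cross u x)]dot_cross
  [cross v u]crossC !linE.
rewrite [dot v u]dotC; vfield.
Qed.

Let cross_sq u x : cross u (cross u x) = dot u x *: u - dot u u *: x.
Proof.
apply: (scalerI n2).
rewrite !scaler_nat mulr2n {2}cross_cross -(scaler_nat 2); vring.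
Qed.

(** Writes D_{u, C u} in the words of A_u and C, using (u, C u) = 0 and A_{C u} = [C, A_u]. *)
Let inn_fun_act u C x : inn_fun u (act C u) x =
  3^-1 *: (dot u x *: act C u + dot u (act C x) *: u + cross u
    (act C (cross u x))
           + dot u u *: act C x).
Proof.
rewrite /inn_fun cross_cross_l -[cross (act C u) x](addrK (cross u (act C x)))
  -act_cross.
have uCu : dot u (act C u) = 0.
  apply: (mulfI n2); rewrite mulr0 mulr_natl mulr2n -{1}[dot _ _]opprK
    -act_skew.
  by rewrite dotC addNr.
by rewrite uCu !linE cross_sq act_skew; vfield.
Qed.

(** A rewriting rule for C A_u C A_u: it is [cross_sq] for the vector C u, with A_{C u} = C A_u -
    A_u C squared and expanded. *)
Let act_cross_act_cross u C x :
  act C (cross u (act C (cross u x))) = cross u (act C (act C (cross u x)))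
  - dot u u *: act C (act C x) + dot u (act C (act C u)) *: x
  - cross u (act C (cross u (act C x))).
Proof.
have := cross_sq (act C u) x.
have crossl y : cross (act C u) y = act C (cross u y) - cross u (act C y).
  by rewrite act_cross addrK.
rewrite !crossl !(linE, actE) !act_skew cross_sq !(linE, actE).
by move=> H; vlincomb (1 : k) H.
Qed.

(* For p = u u^T everything is expressed with the words in A_u and C, normalized
   by act_cross_act_cross and cross_sq. *)
Lemma mul_tmap_sq p C :
  2 *: actW C (actW C p) + tmap (C \s* phi p C) = mul p (tmap (C \s* C)).
Proof.
have lF : linear (fun p => 2 *: actW C (actW C p) + tmap (C \s* phi p C)).
  by move=> t q r; rewrite !linearP add_lfunE scale_lfunE linearPr linearP;
    vring.
have lG : linear (fun p => mul p (tmap (C \s* C))).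
  by move=> t q r; rewrite !linearP add_lfunE scale_lfunE.
apply: (sym2_ext_sq n2 lF lG) => u; apply: op_inj => x.
rewrite phi_sq op_mul_sq linearD linearZ /= add_lfunE scale_lfunE !op_actW
  !op_sq.
rewrite op_tmapE /tmap_fun !act_inn.
rewrite (tr_act2C C) (eq_tr (fun x => act_inn _ _ _)) tr_inn_act.
rewrite !inn_fun_act !op_tmap (eq_tr (fun x => op_tmap _ _)) tr_sub !trZ tr_id.
rewrite !(actE, linE) act_cross_act_cross cross_sq.
set t := tr _.
have n6 : 6%:R != 0 :> k by rewrite (natrM _ 2 3) mulf_neq0.
vfield.
Qed.

(** By polarization it suffices to treat A^2 and C^2, whose product is S(2 C.(C.A^2) + C S(A^2)(C)).
    As T is equivariant and S = Phi o T, this is Phi of the left side of [mul_tmap_sq] at p =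
    T(A^2). *)
Lemma cg_prod_factor t s : cg_prod L 4 t s = phi (mul (tmap t) (tmap s)).
Proof.
have n4 : 4%:R != 0 :> k by rewrite (natrM _ 2 2) mulf_neq0.
have lF (u : sym2 L) : linear (fun t => cg_prod L 4 t u).
  by move=> c q r; rewrite linearP add_lfunE scale_lfunE.
have lG (u : sym2 L) : linear (fun t => phi (mul (tmap t) (tmap u))).
  by move=> c q r; rewrite !linearP add_lfunE scale_lfunE linearP.
apply: (sym2_ext_sq n2 (lF s) (lG s)) => A.
have lF' : linear (fun s => cg_prod L 4 (A \s* A) s) by move=> c q r; rewrite
  linearP.
have lG' : linear (fun s => phi (mul (tmap (A \s* A)) (tmap s))).
  by move=> c q r; rewrite !linearP.
apply: (sym2_ext_sq n2 lF' lG') => C.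
rewrite cg_prodE // -mul_tmap_sq -cg_S_factor -!tmap_actW -linearZ -linearD
  -cg_S_factor.
have brE (X Y : L) : bullet (ad X) (ad X) Y = lie_br X (lie_br X Y).
  by rewrite /bullet scale_lfunE add_lfunE !comp_lfunE !adE half_double.
set u := sym2_act C _; set v := C \s* _.
have uE : u = 2 *: (lie_br C (lie_br C A) \s* A) + 2 *:
  (lie_br C A \s* lie_br C A).
  rewrite /u sym2_actE linearD /= !sym2_actE [A \s* lie_br _ _]sprodC; vring.
have vE : v = 4 *: (C \s* lie_br A (lie_br A C)) + killing A C *: (C \s* A).
  rewrite /v cg_S_sprod; have := brE A C; move: (bullet _ _) => b bE.
  rewrite add_lfunE !scale_lfunE add_lfunE !killing_opE bE.
  by rewrite half_double linearDr !linearZr_LR.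
rewrite uE vE /cg_formula !brE.
have -> : lie_br A C \s* lie_br A C = lie_br C A \s* lie_br C A.
  by rewrite (lie_brC A C) linearNl linearNr opprK.
rewrite [lie_br C (lie_br C A) \s* A]sprodC [lie_br A (lie_br A C) \s* C]sprodC.
rewrite [C \s* A]sprodC.
rewrite !linearD !linearZ /=; vfield.
Qed.

(** * Surjectivity of T and injectivity of Phi *)

Definition sym_id := sym_of id.

Let op_id x : op sym_id x = x. Proof. exact: op_sym_of. Qed.

Let dot_cross_cross u v x y : dot x (cross u (cross v y)) = dot y
  (cross v (cross u x)).
Proof.
rewrite -dot_cross -dot_cross [LHS]dotC; congr (dot _ _).
by rewrite [LHS]crossC [cross x u]crossC crossNr opprK.
Qed.

Let n9 : 9%:R != 0 :> k. Proof. by rewrite (natrM _ 3 3) mulf_neq0. Qed.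

(** Let M_x be the map sending w to D_{u,w} x. The sum is the trace of M_x^T M_y, where M_x^T z =
    (u, x) z - (u, z) x + 1/3 [cross u (cross x z)]. *)
Let tr_inn_adj u x y :
  \sum_i dot (inn_fun u (e i) y) (inn_fun u (f i) x) =
  16 / 9 * (dot u x * dot u y) + 8 / 9 * (dot u u * dot x y).
Proof.
rewrite (_ : \sum_i _ = tr (fun w => dot u x *: inn_fun u w y
    - dot u (inn_fun u w y) *: x + 3^-1 *: cross u (cross x (inn_fun u w y))));
      last first.
  apply: eq_bigr => i _; rewrite [inn_fun u (f i) x]/inn_fun; move:
    (inn_fun _ _ _) => z.
  have -> : dot z (dot u x *: f i - dot (f i) x *: u - 3^-1 *: cross
    (cross u (f i)) x) =
      dot u x * dot (f i) z - dot (f i) x * dot u z - 3^-1 * dot z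
        (cross (cross u (f i)) x).
    by rewrite !linE [dot z u]dotC [dot (f i) z]dotC.
  have -> : dot z (cross (cross u (f i)) x) = - dot (f i) (cross u (cross x z)).
    by rewrite [cross _ x]crossC dotNr dot_cross_cross.
  by rewrite !linE; ring.
have linB a b : linear (fun w => inn_fun a w b).
  by move=> c w w'; rewrite -!act_inn inn_linearr act_linear.
rewrite trD tr_sub !trZ tr_dyad_comp //.
have trB : tr (fun w => inn_fun u w y) = 4 * dot u y.
  apply: (mulfI n3); rewrite tr_inn_id [dot y u]dotC; ring.
have trAAB : 3 * tr (fun w => cross u (cross x (inn_fun u w y))) =
    - 18 * (dot u y * dot u x) + 3 * (dot u y * dot u x - dot u u * dot x y)
    + (dot u y * dot u x - dot u u * dot x y) + 6 * dot u u * dot x y.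
  rewrite -trZ (eq_tr (h := fun w => (3 * dot u y) *: cross u (cross x w)
     - 3 *: (dot y w *: cross u (cross x u)) + cross u
       (cross x (cross y (cross u w))))); last first.
    move=> w; rewrite /inn_fun [cross (cross _ _) y]crossC [dot w y]dotC !linE;
      vfield.
  rewrite trD tr_sub !trZ tr_cross_cross tr_dyad.
  rewrite (@tr_comp (cross u) (fun w => cross x (cross y (cross u w)))); last 2
    first.
  - by move=> c w w'; rewrite !linE.
  - by move=> c w w'; rewrite !linE.
  rewrite [X in _ + X](eq_tr (h := fun w => dot u w *: cross x (cross y u)
    - dot u u *: cross x (cross y w))); last by move=> w; rewrite cross_sq
      !linE.
  rewrite tr_sub trZ tr_dyad tr_cross_cross [cross y u]crossC !linE.
  rewrite [dot u (cross x _)]dot_cross_cross [cross x u]crossC !linE cross_sq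
    !linE.
  rewrite [dot y u]dotC [dot y x]dotC; ring.
rewrite trB; move: trAAB; set t := tr _ => tE.
have -> : t = 3^-1 * (3 * t) by field.
rewrite tE /inn_fun [cross (cross u x) y]crossC !linE dot_cross_cross
  [cross y u]crossC !linE cross_sq !linE.
rewrite [dot x u]dotC; field; exact/andP.
Qed.

Let sum_inn u x :
  \sum_i act (inn u (f i)) (act (inn u (e i)) x) =
    - (16 / 9 * dot u x) *: u - (8 / 9 * dot u u) *: x.
Proof.
apply: dot_nondeg => y; rewrite dot_sumr.
under eq_bigr => i _ do rewrite dotC act_skew !act_inn.
rewrite sumrN tr_inn_adj !linE [dot y u]dotC [dot y x]dotC; ring.
Qed.

Let sum_inn' u x :
  \sum_i act (inn u (e i)) (act (inn u (f i)) x) =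
    - (16 / 9 * dot u x) *: u - (8 / 9 * dot u u) *: x.
Proof.
apply: dot_nondeg => y; rewrite dot_sumr.
under eq_bigr => i _ do rewrite -[dot y _]opprK -act_skew !act_inn.
rewrite sumrN tr_inn_adj !linE [dot y u]dotC [dot y x]dotC; ring.
Qed.

(** Produces elements of the image of T that are combinations of u^2 and the identity, with an
    invertible coefficient at u^2. *)
Let tmap_sum_inn u : tmap (\sum_i inn u (e i) \s* inn u (f i)) =
  - (64 / 3) *: (u \s* u) - (8 / 3 * dot u u) *: sym_id.
Proof.
apply: op_inj => x; rewrite linear_sum linear_sum sum_lfunE.
under eq_bigr => i _ do rewrite op_tmapE /tmap_fun.
rewrite sumrB -scaler_sumr big_split /= sum_inn sum_inn' -scaler_suml.
(* The trace of the operator in [sum_inn'] is -(16 + 7 . 8) / 9 = -8 times (u, u). *)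
rewrite (_ : \sum_i tr _ = - 8 * dot u u).
  rewrite linearB !linearZ /= !(add_lfunE, opp_lfunE, scale_lfunE) op_sq op_id;
    vfield.
rewrite exchange_big /=.
under eq_bigr => j _ do rewrite -dot_sumr sum_inn' !linE.
rewrite big_split /= sumrN -!mulr_sumr.
have -> : \sum_i dot (f i) (e i) = 7%:R by [].
have -> : \sum_i - (16 / 9 * dot u (e i)) * dot (f i) u = - (16 / 9) * dot u u.
  rewrite -(tr_dyad u u) mulr_sumr; apply: eq_bigr => i _.
  by rewrite dotZr; ring.
by field; rewrite n9.
Qed.

Let in_tmap_sq u : u \s* u \in limg tmap.
Proof.
have n64 : 64%:R != 0 :> k by rewrite (natrX _ 2 6) expf_neq0.
have in_tmap v : - (64 / 3) *: (v \s* v) - (8 / 3 * dot v v) *: sym_id \in limg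
  tmap.
  by rewrite -tmap_sum_inn memv_img ?memvf.
(* Polarizing at e_i and f_i and summing over i gives -(128 + 16 . 7) / 3 = -80 times the identity,
   which is thus in the image of T; then so is every square. *)
have idE : (- 80%:R) *: sym_id = \sum_i
   ((- (64 / 3) *: ((e i + f i) \s* (e i + f i)) -
     (8 / 3 * dot (e i + f i) (e i + f i)) *: sym_id)
   - (- (64 / 3) *: (e i \s* e i) - (8 / 3 * dot (e i) (e i)) *: sym_id)
   - (- (64 / 3) *: (f i \s* f i) - (8 / 3 * dot (f i) (f i)) *: sym_id)).
  rewrite (eq_bigr (fun i => - (128 / 3) *: (e i \s* f i) -
    (16 / 3 * dot (e i) (f i)) *: sym_id)).
    rewrite sumrB -scaler_sumr -scaler_suml -mulr_sumr sum_dot_dual.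
    rewrite -[\sum_i _]/sym_id; vfield.
  move=> i _; rewrite linearDl !linearDr /= [f i \s* e i]sprodC.
  rewrite !linE [dot (f i) (e i)]dotC; vfield.
have id_in : sym_id \in limg tmap.
  have n80 : - 80%:R != 0 :> k.
    by rewrite oppr_eq0 (natrM _ 16 5) (natrX _ 2 4) mulf_neq0 ?expf_neq0.
  rewrite -[sym_id]scale1r -(mulVf n80) -scalerA idE; apply/memvZ/memv_suml => i
    _.
  by apply: memvB; [apply: memvB|]; apply: in_tmap.
rewrite (_ : u \s* u = (- (64 / 3))^-1 *:
  ((- (64 / 3) *: (u \s* u) - (8 / 3 * dot u u) *: sym_id)
    + (8 / 3 * dot u u) *: sym_id)); last first.
  by rewrite subrK scalerA mulVf ?scale1r // oppr_eq0 mulf_neq0 ?invr_eq0.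
by apply/memvZ/memvD; [apply: in_tmap | apply: memvZ].
Qed.

Lemma tmap_surj q : q \in limg tmap.
Proof.
rewrite [q]sym2_span; apply: memv_suml => ij _; apply: memvZ.
have half_sq a b : a \s* b = 2^-1 *: ((a + b) \s* (a + b) - a \s* a - b \s* b).
  by rewrite linearDl !linearDr /= [b \s* a]sprodC; vfield.
by rewrite half_sq; apply/memvZ/memvB; [apply: memvB|]; apply: in_tmap_sq.
Qed.

(* As tr(phi p C \o C) = 2 tr(p C^2), phi p = 0 determines the trace pairing of
   p with the elements tmap (C \s* C), and these span. *)
Lemma phi_inj p : phi p = 0 -> p = 0.
Proof.
move=> p0; pose b q : k := tr (fun x => op p (op q x)).
have opl q : linear (op q) by move=> c x y; rewrite linearP.
have tr0 C : tr (fun x => op p (act C (act C x))) = 0.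
  apply: (mulfI n2); rewrite mulr0 mulr_natl mulr2n.
  rewrite {2}(@tr_comp (fun x => op p (act C x)) (act C)); last 2 first.
  - by move=> c x y; rewrite actP linearP.
  - exact: actP.
  rewrite -tr_phi p0 (eq_tr (h := fun x => 0 *: x)) ?(trZ 0 id) ?mul0r // => x.
  by rewrite lfunE /= act0l scale0r.
(* For q = T(C^2) the pairing is - tr(C^2) tr(p), because tr(p C^2) = 0, while tr(q) = (12 - 7)
   tr(C^2). By surjectivity of T this covers all q. *)
have bE q : b q = - 5^-1 * tr (op p) * tr (op q).
  pose F q : k^o := b q.
  pose G q : k^o := - 5^-1 * tr (op p) * tr (op q).
  have trop (c : k) q' r : tr (op (c *: q' + r)) = c * tr (op q') + tr (op r).
    by rewrite -trZ -trD; apply: eq_tr => x; rewrite linearP add_lfunE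
      scale_lfunE.
  have lF : linear (fun t => F (tmap t)).
    move=> c t s; have -> : c *: F (tmap t) + F (tmap s) = c * F (tmap t) + F
      (tmap s) by [].
    rewrite /F /b -trZ -trD; apply: eq_tr => x.
    by rewrite !linearP add_lfunE scale_lfunE linearP.
  have lG : linear (fun t => G (tmap t)).
    move=> c t s; have -> : c *: G (tmap t) + G (tmap s) = c * G (tmap t) + G
      (tmap s) by [].
    by rewrite /G linearP trop; ring.
  have /memv_imgP[t _ ->] := tmap_surj q.
  rewrite -/(F _) -/(G _); apply: (sym2_ext_sq n2 lF lG) => C; rewrite /F /G /b.
  rewrite (eq_tr (h := fun x => 12 *: op p (act C (act C x))
     - tr (fun x => act C (act C x)) *: op p x)); last first.
    by move=> x; rewrite op_tmap linearB !linearZ.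
  rewrite tr_sub !trZ tr0 (eq_tr (fun x => op_tmap C x)) tr_sub !trZ tr_id.
  by field.
(* With q the identity, tr(p) = -7/5 tr(p), so that 12 tr(p) = 0. *)
have trp : tr (op p) = 0.
  have := bE sym_id; rewrite /b (eq_tr (h := op p)) => [|x]; last by rewrite
    op_id.
  rewrite (eq_tr op_id) tr_id => E.
  have n12 : 12%:R != 0 :> k by rewrite (natrM _ 4 3) (natrX _ 2 2) mulf_neq0
    ?expf_neq0.
  apply: (mulfI n12); rewrite mulr0.
  transitivity (5 * (tr (op p) - - 5^-1 * tr (op p) * 7)); last by rewrite -E
    subrr mulr0.
  by field.
apply: op_inj => v; rewrite linear0 lfunE /=; apply: dot_nondeg => u; rewrite
  dot0r.
(* The pairing with uv is (u, p v), hence all entries of p vanish. *)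
have := bE (u \s* v); rewrite trp mulr0 mul0r => <-.
rewrite /b (eq_tr (h := fun x => 2^-1 *: (dot v x *: op p u) + 2^-1 *:
  (dot u x *: op p v))).
  by rewrite trD !trZ !tr_dyad -op_sym dotC; field.
by move=> x; rewrite opE linearZ /= linearD /= !linearZ /=; vring.
Qed.

(** * The isomorphism for an abstract cross product *)

Lemma cg_alg_isomorphic : alg_isomorphic (cg_mul L 4) (fun p q => mul p q).
Proof.
set A := cg_space L 4.
(* The inverse of Phi: T applied to a chosen preimage under S. The choice does not matter, since
   Phi(g x) = x and Phi is injective. *)
pose g : 'Hom(subvs_of A, sym2 W) := linfun
  (fun X : subvs_of A => tmap ((cg_S L 4)^-1%VF (vsval X))).
have gE (x : subvs_of A) : g x = tmap ((cg_S L 4)^-1%VF (vsval x)).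
  by rewrite /g linfunE // => c y z; rewrite !linearP.
have phi_in p : phi p \in A.
  by have /memv_imgP[t _ ->] := tmap_surj p; rewrite -cg_S_factor memv_img
    ?memvf.
have phig (x : subvs_of A) : phi (g x) = vsval x.
  by rewrite gE -cg_S_factor limg_lfunVK ?subvsP.
have phi_injective : injective phi.
  by move=> p q pq; apply: subr0_eq; apply: phi_inj; rewrite linearB /= pq
    subrr.
have gphi p : g (vsproj A (phi p)) = p.
  by apply: phi_injective; rewrite phig vsprojK.
exists (g : {linear _ -> _}).
  exists (fun p => vsproj A (phi p)) => [x|p]; last exact: gphi.
  by rewrite phig vsvalK.
move=> x y; apply: phi_injective; rewrite /= phig.
have S_g (z : subvs_of A) : {t | z = vsproj A (cg_S L 4 t) & g z = tmap t}.
  exists ((cg_S L 4)^-1%VF (vsval z)); last exact: gE.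
  by rewrite limg_lfunVK ?subvsP // vsvalK.
have [t xE ->] := S_g x; have [u yE ->] := S_g y.
by rewrite xE yE cg_mul_S // cg_prod_factor.
Qed.

End CrossProduct.

(** * Dual bases for a nondegenerate form *)

Section DualBasis.

Variables (k : fieldType) (W : vectType k) (dot : W -> W -> k).
Hypothesis dotC : forall a b, dot a b = dot b a.
Hypothesis dotP : forall c a b d, dot (c *: a + b) d = c * dot a d + dot b d.
Hypothesis dot_nondegenerate : forall a, (forall b, dot a b = 0) -> a = 0.

Local Notation n := (\dim {:W}).
Local Notation basis := (vbasis {:W}).

(** The map h sends w to the vector with coordinates (w, b_i) in the basis b. Its kernel is zero by
    nondegeneracy, so it is invertible, and f_i is the preimage of b_i. *)
Lemma dual_basis_exists :
  {f : 'I_n -> W | forall i x, dot (f i) x = coord basis i x}.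
Proof.
have dotPr d c a b : dot d (c *: a + b) = c * dot d a + dot d b by rewrite
  !(dotC d).
have dot_sum d (c : 'I_n -> k) (F : 'I_n -> W) :
    dot d (\sum_i c i *: F i) = \sum_i c i * dot d (F i).
  have lfm : linear (dot d : W -> k^o) by move=> c' a b; rewrite dotPr.
  rewrite -(linfunE lfm) linear_sum; apply: eq_bigr => i _.
  by rewrite linearZ /= linfunE.
pose h := linfun (fun w => \sum_(i < n) dot w basis`_i *: basis`_i).
have hE w : h w = \sum_(i < n) dot w basis`_i *: basis`_i.
  rewrite /h linfunE // => c a b; rewrite scaler_sumr -big_split.
  by apply: eq_bigr => i _; rewrite dotP scalerDl scalerA.
have free_basis : free basis by apply: basis_free (vbasisP _).
have coord_h (i : 'I_n) w : coord basis i (h w) = dot w basis`_i.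
  by rewrite hE coord_sum_free.
have h0 : lker h == 0%VS.
  apply/lker0P => a b ab; apply: subr0_eq; apply: dot_nondegenerate => x.
  rewrite [x](coord_vbasis (memvf x)) dot_sum big1 // => i _.
  by rewrite -coord_h linearB /= ab subrr linear0 mulr0.
exists (fun i => (h^-1)%VF basis`_i) => i x.
rewrite {1}[x](coord_vbasis (memvf x)) dot_sum (bigD1 i) //= big1 => [|j ji].
  by rewrite -coord_h lker0_lfunVK // coord_free // eqxx mulr1 addr0.
by rewrite -coord_h lker0_lfunVK // coord_free // eq_sym (negPf ji) mulr0.
Qed.

Lemma lftrace_coord (g : 'End(W)) : lftrace g = \sum_(i < n) coord basis i
  (g basis`_i).
Proof.
by apply: eq_bigr => i _; rewrite !mxE /= passmx.vecof_delta.
Qed.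

End DualBasis.

(** * Octonions *)

Section PureOctonions.

Variables (k : fieldType) (O : octonionAlgebra k).
Hypotheses (n2 : 2%:R != 0 :> k).

Local Notation "x ** y" := (oct_mul x y) (at level 40).
Local Notation e := (@oct_unit k O).
Local Notation W := (subvs_of (pure O)).
Implicit Types (x y z : O) (a b c : W).

Lemma form_norm x : oct_form x x = 2 * oct_norm x.
Proof. by rewrite /oct_form /polar -mulr2n -scaler_nat oct_normZ; ring. Qed.

Lemma oct_nondeg x y : (forall z, oct_form x z = oct_form y z) -> x = y.
Proof.
move=> xy; apply: subr0_eq; apply: oct_nondegenerate => z.
by rewrite -[polar _ _ _]/(oct_form _ z) linearBl /= xy subrr.
Qed.

Lemma form_unit_pure a : oct_form e (vsval a) = 0.
Proof. by apply/eqP; rewrite -mem_pure subvsP. Qed.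

(** If N(e) were not 1, then N(x) = N(e) N(x) would force N = 0, and nondegeneracy would leave only
    the zero space. *)
Lemma norm_unit : oct_norm e = 1.
Proof.
apply/eqP; apply: contraT => Ne1.
have N0 x : oct_norm x = 0.
  have /eqP := oct_normM e x; rewrite oct_mul1l -subr_eq0 -{1}[oct_norm x]mul1r
    -mulrBl.
  by rewrite mulf_eq0 subr_eq0 eq_sym (negPf Ne1) => /eqP.
have O0 : fullv = 0%VS :> {vspace O}.
  apply/eqP; rewrite -subv0; apply/subvP => x _; rewrite memv0; apply/eqP.
  by apply: oct_nondegenerate => y; rewrite /polar !N0 !subr0.
by have := oct_dim O; rewrite O0 dimv0.
Qed.

Lemma form_unit_unit : oct_form e e = 2.
Proof. by rewrite form_norm norm_unit mulr1. Qed.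

Lemma unit_neq0 : e != 0.
Proof.
apply/eqP => e0; have := norm_unit; rewrite e0 -(scale0r e) oct_normZ expr2
  !mul0r.
by move=> /esym/eqP; rewrite oner_eq0.
Qed.

Lemma form_mul_skewl a x y :
  oct_form (vsval a ** x) y = - oct_form x (vsval a ** y).
Proof.
apply/eqP; rewrite -addr_eq0 [oct_form x _]oct_formC; apply/eqP.
have := oct_formM (vsval a) x e y; rewrite !oct_mul1l => ->.
by rewrite oct_formC form_unit_pure mul0r.
Qed.

Lemma form_mul_skewr a x y :
  oct_form (x ** vsval a) y = - oct_form x (y ** vsval a).
Proof.
apply/eqP; rewrite -addr_eq0; apply/eqP.
have := oct_formM x (vsval a) y e; rewrite !oct_mul1r => ->.
by rewrite [oct_form (vsval a) e]oct_formC form_unit_pure mulr0.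
Qed.

(** Paired with z, with a and b moved to the other argument by skewness, this is the composition
    identity [oct_formM]. It is the Clifford relation behind [cross_cross]. *)
Lemma mul_mul_pure a b x : vsval a ** (vsval b ** x) + vsval b ** (vsval a ** x)
  =
  - oct_form (vsval a) (vsval b) *: x.
Proof.
apply: oct_nondeg => z; rewrite linearDl linearZl_LR /= !form_mul_skewl mulNr.
have := oct_formM (vsval a) x (vsval b) z.
rewrite [oct_form (vsval a ** z) _]oct_formC => <-; rewrite !form_mul_skewl;
  ring.
Qed.

Lemma mul_pureC a b : vsval a ** vsval b + vsval b ** vsval a =
  - oct_form (vsval a) (vsval b) *: e.
Proof. by rewrite -mul_mul_pure !oct_mul1r. Qed.

Definition dot a b : k := 2^-1 * oct_form (vsval a) (vsval b).
Definition cross a b : W := malcevW (2^-1 *: a) b.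

Lemma dotC a b : dot a b = dot b a. Proof. by rewrite /dot oct_formC. Qed.

Lemma dotP (t : k) a b c : dot (t *: a + b) c = t * dot a c + dot b c.
Proof. by rewrite /dot linearP linearPl /=; ring. Qed.

Lemma crossC a b : cross a b = - cross b a.
Proof. by rewrite /cross malcevWC !linearZl_LR linearZr_LR. Qed.

Lemma val_cross a b : vsval (cross a b) = vsval a ** vsval b + dot a b *: e.
Proof.
rewrite /cross linearZl_LR linearZ /= malcevWE /malcev /dot.
have -> : vsval b ** vsval a = - oct_form (vsval a) (vsval b) *: e - vsval a **
  vsval b.
  by rewrite -mul_pureC addrC addKr.
by vfield.
Qed.

Lemma mul_val a b : vsval a ** vsval b = vsval (cross a b) - dot a b *: e.
Proof. by rewrite val_cross addrK. Qed.

Lemma crossP (t : k) a b c : cross (t *: a + b) c = t *: cross a c + cross b c.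
Proof. by rewrite /cross !linearZl_LR linearPl; vring. Qed.

Lemma form_pure_unit a : oct_form (vsval a) e = 0.
Proof. by rewrite oct_formC form_unit_pure. Qed.

Lemma dot_cross a b c : dot (cross a b) c = dot a (cross b c).
Proof.
rewrite /dot !val_cross linearDl linearDr linearZl_LR linearZr_LR /=.
rewrite form_unit_pure form_pure_unit form_mul_skewr.
have -> : vsval c ** vsval b = - oct_form (vsval c) (vsval b) *: e - vsval b **
  vsval c.
  by rewrite -mul_pureC addrK.
rewrite linearBr linearZr_LR /= form_pure_unit; ring.
Qed.

(** Substitute ab = a x b - (a, b) e in [mul_mul_pure]. The multiples of e cancel because (b, a x c)
    = - (a, b x c). *)
Lemma cross_cross a b c : cross a (cross b c) =
  - cross b (cross a c) + dot a c *: b + dot b c *: a - (2 * dot a b) *: c.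
Proof.
have crossx d x t : vsval d ** (x + t *: e) = vsval d ** x + t *: vsval d.
  by rewrite linearDr linearZr_LR /= oct_mul1r.
have pE := val_cross a (cross b c); have qE := val_cross b (cross a c).
rewrite (val_cross b c) crossx in pE; rewrite (val_cross a c) crossx in qE.
have dotE : dot b (cross a c) = - dot a (cross b c).
  by rewrite -!dot_cross [cross b a]crossC -scaleN1r -[-1 *: _]addr0 dotP /dot
    linear0 linear0l; ring.
rewrite dotE in qE; have E := mul_mul_pure a b (vsval c).
move: (cross a (cross b c)) (cross b (cross a c)) (dot a (cross b c)) pE qE => p
  q t.
move: (_ ** (_ ** _)) E => r E; move: (_ ** (_ ** _)) E => s E pE qE.
have -> : 2 * dot a b = oct_form (vsval a) (vsval b) by rewrite mulrA mulfV //
  mul1r.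
apply: subvs_inj; rewrite !(linearD, linearN, linearZ) /= pE qE.
rewrite -[r](addrK s) E; vring.
Qed.

Lemma split_pure x : x = (2^-1 * oct_form e x) *: e
  + vsval (vsproj (pure O) (x - (2^-1 * oct_form e x) *: e)).
Proof.
rewrite vsprojK; first by rewrite addrC subrK.
rewrite mem_pure linearBr linearZr_LR /= form_unit_unit.
by apply/eqP; field.
Qed.

Lemma dot_nondegenerate a : (forall b, dot a b = 0) -> a = 0.
Proof.
move=> a0; apply: subvs_inj; rewrite linear0; apply: oct_nondegenerate => y.
rewrite -[polar _ _ _]/(oct_form _ _) [y]split_pure linearDr linearZr_LR /=.
rewrite form_pure_unit mulr0 add0r; apply: (mulfI (invr_neq0 n2)).
by rewrite mulr0; apply: a0.
Qed.

Lemma dim_pure : \dim {:W} = 7.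
Proof.
have -> : \dim {:W} = \dim (pure O) by exact: dimvf.
pose l := linfun (oct_form e : O -> k^o).
have := limg_ker_dim l fullv; rewrite capfv oct_dim.
have -> : \dim (limg l) = 1%N.
  apply/eqP; rewrite eqn_leq; apply/andP; split.
    by rewrite (leq_trans (dimvS (subvf _))) // dimvf.
  rewrite lt0n dimv_eq0; apply: contra n2 => /eqP l0.
  have := memv_img l (memvf e); rewrite l0 memv0 /l linfunE ?form_unit_unit //.
  by move=> t x y; exact: (oct_polar_bilinear O).2.
by rewrite addn1 => -[].
Qed.

(** * The action of the derivations on W *)

Implicit Types (X Y : der_lie O).

Lemma der_mul X x y : vsval X (x ** y) = vsval X x ** y + x ** vsval X y.
Proof. by have /mem_derivations := subvsP X. Qed.

Lemma der_unit X : vsval X e = 0.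
Proof.
have := der_mul X e e; rewrite oct_mul1l oct_mul1r oct_mul1l.
by rewrite -{1}[vsval X e]addr0 => /addrI.
Qed.

(** X kills aa, a multiple of e. With X a = t e + b and b pure, the derivation rule gives 2 t a =
    <b, a> e, and both sides vanish since a is orthogonal to e. *)
Lemma der_pure X a : vsval X (vsval a) \in pure O.
Proof.
have [-> | a0] := eqVneq (vsval a) 0; first by rewrite linear0 mem0v.
have aa : vsval a ** vsval a = (2^-1 * - oct_form (vsval a) (vsval a)) *: e.
  by rewrite -scalerA -mul_pureC; vfield.
have := der_mul X (vsval a) (vsval a); rewrite aa linearZ /= der_unit scaler0.
set y := vsval X _; rewrite [y]split_pure; set t := _ * _; set b := vsproj _ _.
have -> : (t *: e + vsval b) ** vsval a + vsval a ** (t *: e + vsval b) =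
    (2 * t) *: vsval a - oct_form (vsval b) (vsval a) *: e.
  rewrite -scaleNr -mul_pureC linearDl linearDr linearZl_LR linearZr_LR /=.
  by rewrite oct_mul1l oct_mul1r; vring.
move=> E; have /eqP : (2 * t) *: vsval a = 0.
  have f0 : oct_form (vsval b) (vsval a) = 0.
    apply: (mulfI n2); rewrite mulr0 mulrC -form_unit_unit.
    have := congr1 (oct_form e) E; rewrite linear0r linearBr !linearZr_LR /=.
    by rewrite form_unit_pure mulr0 sub0r => /eqP; rewrite eq_sym oppr_eq0 =>
      /eqP.
  by rewrite E f0 scale0r subr0.
rewrite scaler_eq0 (negPf a0) orbF mulf_eq0 (negPf n2) => /eqP ->.
by rewrite scale0r add0r subvsP.
Qed.

Definition act X a : W := vsproj (pure O) (vsval X (vsval a)).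

Lemma val_act X a : vsval (act X a) = vsval X (vsval a).
Proof. by rewrite vsprojK // der_pure. Qed.

Lemma actP X (t : k) a b : act X (t *: a + b) = t *: act X a + act X b.
Proof. by rewrite /act !linearP. Qed.

Lemma act_linear (t : k) X Y a : act (t *: X + Y) a = t *: act X a + act Y a.
Proof. by rewrite /act linearP /= add_lfunE scale_lfunE linearP. Qed.

(** X kills ab + ba = - <a, b> e; expanding by the derivation rule leaves <X a, b> + <a, X b> times
    e. *)
Lemma act_skew X a b : dot (act X a) b = - dot a (act X b).
Proof.
apply/eqP; rewrite -addr_eq0 /dot !val_act -mulrDr mulf_eq0 invr_eq0 (negPf n2)
  /=.
have := congr1 (vsval X) (mul_pureC a b).
rewrite linearD linearZ /= der_unit scaler0 !der_mul -!val_act => E.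
have /eqP : (oct_form (vsval (act X a)) (vsval b) +
    oct_form (vsval a) (vsval (act X b))) *: e = 0.
  apply: oppr_inj; rewrite oppr0 -E scalerDl opprD -!scaleNr -!mul_pureC; vring.
by rewrite scaler_eq0 (negPf unit_neq0) orbF !val_act.
Qed.

Lemma act_cross X a b : act X (cross a b) = cross (act X a) b + cross a
  (act X b).
Proof.
have vD (p q : W) : vsval (p + q) = vsval p + vsval q by exact: linearD.
apply: subvs_inj; rewrite vD val_act !val_cross linearD linearZ /= der_unit
  scaler0.
by rewrite der_mul act_skew !val_act addr0; vring.
Qed.

Lemma act_br X Y a : act (lie_br X Y) a = act X (act Y a) - act Y (act X a).
Proof.
apply: subvs_inj; rewrite linearB /= !val_act der_brE add_lfunE opp_lfunE.
by rewrite !comp_lfunE.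
Qed.

Lemma act_inj X Y : act X =1 act Y -> X = Y.
Proof.
move=> XY; apply: subvs_inj; apply/lfunP => x; rewrite [x]split_pure.
move: (2^-1 * _) (vsproj _ _) => t a.
by rewrite !linearD !linearZ /= !der_unit -!val_act XY.
Qed.

Hypothesis n3 : 3%:R != 0 :> k.

Let proj x : W := vsproj (pure O) (x - (2^-1 * oct_form e x) *: e).

Let proj_linear : linear proj.
Proof.
move=> t x y; rewrite /proj -linearP; congr (vsproj _ _).
by rewrite linearPr /=; vring.
Qed.

Let projE (t : k) a : proj (t *: e + vsval a) = a.
Proof.
rewrite /proj linearDr linearZr_LR /= form_unit_unit form_unit_pure addr0.
rewrite mulrCA mulVf // mulr1 addrAC subrr add0r; exact: vsvalK.
Qed.

Let inn_op a b : 'End(O) := linfun (fun x => vsval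
  (inn_fun dot cross a b (proj x))).

Let inn_opE a b x : inn_op a b x = vsval (inn_fun dot cross a b (proj x)).
Proof.
rewrite /inn_op linfunE // => t y z; rewrite proj_linear.
by rewrite (inn_fun_linear dotC dotP crossP crossC) linearP.
Qed.

(** D_{a,b} is extended by 0 on e. Since (s e + p)(t e + q) = (s t - (p, q)) e + s q + t p + p x q,
    a skew derivation of the cross product extends in this way to a derivation of the octonions. *)
Let inn_der a b : inn_op a b \in derivations O.
Proof.
have split z : exists (s : k) (p : W), z = s *: e + vsval p by do 2!eexists;
  exact: split_pure.
apply/mem_derivations => x y; rewrite !inn_opE.
have [s [p ->]] := split x; have [t [q ->]] := split y.
have mul_split (c d : k) (z w : O) :
    (c *: e + z) ** (d *: e + w) = c *: (d *: e) + c *: w + d *: z + z ** w.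
  rewrite linearDl !linearDr /= !linearZl_LR !linearZr_LR /=
    !(oct_mul1l, oct_mul1r).
  by vring.
rewrite mul_split mul_val.
have -> : s *: (t *: e) + s *: vsval q + t *: vsval p +
  (vsval (cross p q) - dot p q *: e) =
    (s * t - dot p q) *: e + vsval (s *: q + t *: p + cross p q).
  by rewrite !linearD !linearZ /=; vring.
rewrite !projE.
have D_lin := inn_fun_linear dotC dotP crossP crossC a b.
have mul_splitr (c : k) (z w : O) : z ** (c *: e + w) = c *: z + z ** w.
  by rewrite linearDr linearZr_LR /= oct_mul1r.
have mul_splitl (c : k) (z w : O) : (c *: e + z) ** w = c *: w + z ** w.
  by rewrite linearDl linearZl_LR /= oct_mul1l.
rewrite mul_splitr mul_splitl -addrA !D_lin.
rewrite (inn_fun_cross n2 n3 dotC dotP crossP crossC dot_cross cross_cross)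
  !mul_val.
have sk := inn_fun_skew dotC dotP crossC dot_cross a b p q.
move: (inn_fun _ _ _ _ p) (inn_fun _ _ _ _ q) sk => p' q' sk.
rewrite sk !linearD !linearZ /=; vring.
Qed.

Definition inn a b : der_lie O := vsproj (derivations O) (inn_op a b).

Lemma act_inn a b c : act (inn a b) c = inn_fun dot cross a b c.
Proof.
apply: subvs_inj; rewrite val_act /inn vsprojK ?inn_der // inn_opE.
by rewrite -[vsval c]add0r -(scale0r e) projE.
Qed.

(** As <a, b> = 2 (a, b) and a * b = 2 (a x b), the coefficients 2/12 and 2 . 4/48 both become
    1/6. *)
Lemma star_sq a b : star_lift O (a \s* a) (b \s* b) =
  6^-1 *: ((4 * dot a b) *: (a \s* b) + dot a a *: (b \s* b)
           + dot b b *: (a \s* a) - cross a b \s* cross a b).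
Proof.
have n6 : 6%:R != 0 :> k by rewrite (natrM _ 2 3) mulf_neq0.
have n12 : 12%:R != 0 :> k by rewrite (natrM _ 2 6) mulf_neq0.
have n48 : 48%:R != 0 :> k by rewrite (natrM _ 4 12) mulf_neq0 // (natrX _ 2 2)
  expf_neq0.
rewrite -[LHS]/(star O _ _) starE /star_formula /cross /dot.
rewrite linearZl_LR /= linearZl_LR linearZr_LR /=; vfield.
Qed.

End PureOctonions.

Theorem theorem3p11 (k : fieldType)
    (hk : forall p : nat, p \in [pchar k] -> (7 < p)%N)
    (O : octonionAlgebra k) :
  alg_isomorphic (cg_mul (der_lie O) 4%:R) (star O).
Proof.
(* The characteristic is 0 or exceeds 7, so the denominators, whose prime factors are 2, 3 and 5,
   are invertible. *)
have nz p : prime p -> (p <= 7)%N -> p%:R != 0 :> k.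
  move=> pp p7; apply/negP => p0; have := hk p.
  by rewrite inE pp p0 ltnNge p7 => /(_ isT).
have n2 := nz 2%N isT isT; have n3 := nz 3%N isT isT; have n5 := nz 5%N isT isT.
have [f fE] := dual_basis_exists (@dotC k O) (@dotP k O) (dot_nondegenerate n2).
have dualE (x : subvs_of (pure O)) :
    x = \sum_i dot (f i) x *: (vbasis {:subvs_of (pure O)})`_i.
  rewrite {1}[x](coord_vbasis (memvf x)); apply: eq_bigr => i _.
  by rewrite fE.
have free_basis : free (vbasis {:subvs_of (pure O)}).
  by apply: basis_free (vbasisP _).
have tr_id : tr (@dot k O) (fun i => (vbasis {:subvs_of (pure O)})`_i) f id =
  7%:R.
  rewrite /tr; under eq_bigr => i _ do rewrite fE coord_free // eqxx.
  by rewrite sumr_const card_ord dim_pure.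
have lftrace_tr (g : 'End(subvs_of (pure O))) :
    lftrace g = tr (@dot k O) (fun i => (vbasis {:subvs_of (pure O)})`_i) f g.
  by rewrite lftrace_coord; apply: eq_bigr => i _; rewrite fE.
exact: (cg_alg_isomorphic n2 n3 (@dotC k O) (@dotP k O) (@crossP k O)
  (@crossC k O)
  (dot_cross n2) (cross_cross n2) dualE tr_id (@actP k O) (act_cross n2)
  (act_skew n2) (@act_linear k O) (act_br n2) (act_inj n2)
  (act_inn n2 n3) lftrace_tr n5 (star_sq n2 n3)).
Qed.
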